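(* Let $\lambda \ge 2$ be the growth factor of a Bundle of Arrays Hash Table (BOA), as defined in the context, with routing table ratio $\beta=\lambda$. Then the BOA supports $N$ insertions with amortized per-entry insertion cost of $O\left(\left(\lambda + \log_{M/B} N + \log_\lambda N\right)/B\right)$ IOs, and a query costs $O(\log_\lambda N)$ IOs with high probability.
   Context: External-memory model: internal memory holds $M$ words, data is transferred between memory and disk in blocks of $B$ words, and cost is measured in block transfers (IOs). A machine word has $\Theta(\log N)$ bits. ''With high probability'' (w.h.p.) means with probability at least $1-1/\mathrm{poly}(N)$. Keys are hashed by a $\Theta(\log N)$-wise independent hash function into a universe of size $\Theta(N^k)$ for some $k\ge 2$; hashed keys are called fingerprints. A fingerprint $K$ is viewed as a string of characters $K_0K_1K_2\cdots$, each character consisting of $\log_2\lambda$ bits; $P_h(K)$ denotes the prefix of $K$ of length $h$ characters. A BOA with growth factor $\lambda$ is a size-tiered log-structured merge structure: it has levels $\ell=1,2,\dots$; each level holds fewer than $\lambda$ runs (sorted arrays of fingerprint-value pairs), each run on level $\ell$ having $B\lambda^{\ell-1}$ entries; when $\lambda$ runs are present on a level they are merged into a single run placed on the next level. Each run is laid out on disk by dividing the key range into equal-width buckets, one per $B$ keys, and writing each bucket's keys in order in a slot of size equal to the fullest bucket, so a bucket's disk address is computable from the key. Each level $\ell$ has a routing filter $F_\ell$, an array of $\lambda^{h_\ell}$ characters indexed by prefixes of length $h_\ell$, where $F_\ell[i]=j$ if the $j$-th run on level $\ell$ contains a fingerprint with prefix $P_{h_\ell}(K)=i$ and no later run on that level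 does; each fingerprint-value pair in a run additionally stores a one-character ''previous'' field naming the previous run on that level containing a fingerprint with the same prefix (or its own run index if none). The routing table ratio is $\beta=\lambda^{h_\ell}/(B\lambda^{\ell-1})$. A query for $K$ consults, on each level, $F_\ell[P_{h_\ell}(K)]$ and then follows the chain of previous fields through the runs, looking up $K$ in each visited run.
   Formalization: Queries: failure is at most N^{-c} with the O-constant depending on a bound for c·log λ (a constant and exponent both uniform in λ are false, e.g. λ=B=N^{1/3}); inserted keys are distinct for queries; M is at least a constant number of blocks and λ≤N. *)

(* Defs.v *)
From mathcomp Require Import all_boot all_order all_algebra.
From mathcomp Require Import reals exp.

Set Implicit Arguments.
Unset Strict Implicit.
Unset Printing Implicit Defensive.

Import Order.TTheory GRing.Theory Num.Theory.

(* Fingerprints are the numbers below growth ^ fplen, read as strings of fplen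
   base-growth characters, most significant character first.  Levels are
   numbered from 1; hlen l is the prefix length h_l of level l. *)
Record boa_params := BoaParams {
  growth : nat;          (* the growth factor lambda *)
  block : nat;           (* B, in words *)
  memory : nat;          (* M, in words *)
  wordbits : nat;
  fplen : nat;
  hlen : nat -> nat
}.

Section Layout.
Variable p : boa_params.

Definition universe : nat := growth p ^ fplen p.

(* The number whose base-growth digits are the first h characters of K. *)
Definition prefix (h K : nat) : nat := K %/ growth p ^ (fplen p - h).

Definition charbits : nat := up_log 2 (growth p).

Definition ceil_div (m d : nat) : nat := (m + d).-1 %/ d.

(* A fingerprint, a one-word value and a one-character "previous" field,
   padded to a whole number of words. *)
Definition entry_words : nat :=
  ceil_div (up_log 2 universe + wordbits p + charbits) (wordbits p).

(* The blocks of size u that meet the interval [a, a + n). *)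
Definition spanned (u a n : nat) : seq nat :=
  if n == 0 then [::] else iota (a %/ u) ((a + n).-1 %/ u - a %/ u).+1.

(* IOs to scan n entries stored contiguously. *)
Definition contig_ios (n : nat) : nat :=
  size (spanned (block p) 0 (n * entry_words)).

(* The filter of level l is packed bitwise: growth ^ h_l characters. *)
Definition filter_ios (l : nat) : nat :=
  size (spanned (block p * wordbits p) 0 (growth p ^ hlen p l * charbits)).

Definition filter_char_ios (i : nat) : nat :=
  size (spanned (block p * wordbits p) (i * charbits) charbits).

(* Bucketed layout of a run whose fingerprints are fps. *)
Definition nbuckets (fps : seq nat) : nat := size fps %/ block p.

Definition bucket (fps : seq nat) (K : nat) : nat :=
  K * nbuckets fps %/ universe.

Definition load (fps : seq nat) (b : nat) : nat :=
  count (fun K => bucket fps K == b) fps.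

Definition slot (fps : seq nat) : nat := \max_(b < nbuckets fps) load fps b.

(* Blocks accessed when the bucket b is read or written: those of its keys and,
   unless the slot is full, of the empty cell that ends them.  The rest of the
   padding of the slot is never transferred. *)
Definition bucket_blocks (fps : seq nat) (b : nat) : seq nat :=
  spanned (block p) (b * slot fps * entry_words)
          (minn (load fps b).+1 (slot fps) * entry_words).

Definition run_ios (fps : seq nat) : nat :=
  size (undup (flatten
    [seq bucket_blocks fps b | b <- iota 0 (nbuckets fps)])).

(* Number of input streams of a merge: one block of memory per input and one
   for the output, besides the insertion buffer of up to B entries. *)
Definition fan_in : nat := memory p %/ block p - entry_words - 1.

End Layout.

Section Operations.
Variables (p : boa_params) (V : Type).

(* A fingerprint-value pair before it is placed in a run. *)
Notation pair := (nat * V)%type.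

Record entry := Entry { fp : nat; value : V; previous : nat }.

(* Runs of a level are indexed by 1, 2, ... from the oldest to the newest.  The
   value 0 of the filter stands for "no run contains this prefix". *)
Record level := Level { runs : seq (seq entry); filter : nat -> nat }.

Definition fps (r : seq entry) : seq nat := [seq fp e | e <- r].

Definition unpack (r : seq entry) : seq pair := [seq (fp e, value e) | e <- r].

Definition empty_level : level := Level [::] (fun=> 0).

Definition le_fp : rel pair := fun x y => x.1 <= y.1.

(* A sorted array on disk, with the number of IOs needed to scan it. *)
Definition tape := (seq pair * nat)%type.

Definition contig (s : seq pair) : tape := (s, contig_ios p (size s)).

Definition chunks (f : nat) (ts : seq tape) : seq (seq tape) :=
  reshape (nseq (ceil_div (size ts) f) f) ts.

(* One pass of multiway merging: every group of f consecutive tapes is merged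
   into a contiguous tape. *)
Definition merge_pass (f : nat) (st : nat * seq tape) : nat * seq tape :=
  let outs := [seq contig (foldr (merge le_fp) [::] [seq t.1 | t <- g])
              | g <- chunks f st.2] in
  (st.1 + sumn [seq t.2 | t <- st.2] + sumn [seq t.2 | t <- outs], outs).

(* With f >= 2, up_log f n passes reduce n tapes to a single one. *)
Definition merge_tapes (ts : seq tape) : nat * seq pair :=
  let: (c, outs) :=
    iter (up_log (fan_in p) (size ts)) (merge_pass (fan_in p)) (0, ts) in
  (c, flatten [seq t.1 | t <- outs]).

(* Append to level l a run made of the sorted contiguous array s.  The array is
   read once to find the fullest bucket and once to write the run; the filter
   is scanned and rewritten along with the latter, since the prefixes met are
   nondecreasing. *)
Definition install (l : nat) (lv : level) (s : seq pair) : nat * level :=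
  let j := (size (runs lv)).+1 in
  let pre K := prefix p (hlen p l) K in
  let run := [seq Entry x.1 x.2
                (if filter lv (pre x.1) == 0 then j else filter lv (pre x.1))
             | x <- s] in
  (contig_ios p (size s) * 2 + run_ios p (fps run) + filter_ios p l * 2,
   Level (rcons (runs lv) run)
         (fun i => if has (fun x => pre x.1 == i) s then j else filter lv i)).

(* Add the sorted contiguous array s to the levels lvs, whose first level has
   number l.  When it is the last of [growth] runs of that level, these runs
   are merged, the filter of the level is cleared, and the result goes to the
   next level.  The filter of a new level is initialized. *)
Fixpoint push (l : nat) (lvs : seq level) (s : seq pair)
    : nat * seq level :=
  match lvs with
  | [::] =>
      let: (c, lv) := install l empty_level s in (filter_ios p l + c, [:: lv])
  | lv :: rest =>
      if (size (runs lv)).+1 < growth p then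
        let: (c, lv') := install l lv s in (c, lv' :: rest)
      else
        let: (c, m) := merge_tapes
          (rcons [seq (unpack r, run_ios p (fps r)) | r <- runs lv]
                 (contig s)) in
        let: (c', rest') := push l.+1 rest m in
        (c + filter_ios p l + c', empty_level :: rest')
  end.

(* [buffer] is kept in internal memory; level l is item l - 1 of [levels]. *)
Record boa := Boa { buffer : seq pair; levels : seq level }.

Definition boa_empty : boa := Boa [::] [::].

Definition insert (t : boa) (x : pair) : nat * boa :=
  let buf := rcons (buffer t) x in
  if size buf < block p then (0, Boa buf (levels t))
  else
    let s := sort le_fp buf in
    let: (c, lvs) := push 1 (levels t) s in
    (contig_ios p (size s) + c, Boa [::] lvs).

(* Total number of IOs of a sequence of insertions, and the resulting BOA. *)
Definition insert_all (xs : seq pair) : nat * boa :=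
  foldl (fun ct x => let: (c, t) := insert ct.2 x in (ct.1 + c, t))
        (0, boa_empty) xs.

(* Follow the previous fields from run j of level l.  A look-up reads the whole
   bucket of K, which holds all entries with the same h_l-prefix.  Run indices
   decrease along the chain, so that n = number of runs is enough fuel. *)
Fixpoint chase (n l : nat) (lv : level) (K j : nat) : nat * seq V :=
  if n isn't n'.+1 then (0, [::]) else
  if j == 0 then (0, [::]) else
  let run := nth [::] (runs lv) j.-1 in
  let c := size (bucket_blocks p (fps run) (bucket p (fps run) K)) in
  let found := rev [seq value e | e <- run & fp e == K] in
  let same e := prefix p (hlen p l) (fp e) == prefix p (hlen p l) K in
  if ohead [seq previous e | e <- run & same e] is Some j' then
    if j' == j then (c, found)
    else let: (c', vs) := chase n' l lv K j' in (c + c', found ++ vs)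
  else (c, found).

Fixpoint query_levels (l : nat) (lvs : seq level) (K : nat)
    : nat * seq V :=
  if lvs isn't lv :: rest then (0, [::]) else
  let i := prefix p (hlen p l) K in
  let: (c, vs) := chase (size (runs lv)) l lv K (filter lv i) in
  let: (c', vs') := query_levels l.+1 rest K in
  (filter_char_ios p i + c + c', vs ++ vs').

(* IOs of the query, and the value associated with the newest entry found for
   K.  The query does not stop at a match, so that its cost bounds the cost of
   the variant that does. *)
Definition query (t : boa) (K : nat) : nat * option V :=
  let: (c, vs) := query_levels 1 (levels t) K in
  (c, ohead (rev [seq x.2 | x <- buffer t & x.1 == K] ++ vs)).

End Operations.

Section Keys.
Variables (p : boa_params) (Key V : Type) (hash : Key -> 'I_(universe p)).

Definition hashed (s : seq (Key * V)) : seq (nat * V) :=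
  [seq (nat_of_ord (hash x.1), x.2) | x <- s].

Definition insertion_ios (s : seq (Key * V)) : nat :=
  (insert_all p (hashed s)).1.

(* IOs of a query for x after the insertions s. *)
Definition query_ios (s : seq (Key * V)) (x : Key) : nat :=
  (query p (insert_all p (hashed s)).2 (hash x)).1.

End Keys.

Local Open Scope ring_scope.

Section Probability.
Variables (R : realType) (Seed : finType) (mu : Seed -> R).

Definition distribution : Prop :=
  (forall w, 0 <= mu w) /\ \sum_w mu w = 1.

Definition Pr (E : pred Seed) : R := \sum_(w | E w) mu w.

(* Any at most kappa distinct keys have independent uniform hashes. *)
Definition kwise_independent (Key : finType) (u kappa : nat)
    (H : Seed -> Key -> 'I_u) : Prop :=
  forall (xs : seq Key) (y : Key -> 'I_u), uniq xs -> (size xs <= kappa)%N ->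
    Pr (fun w => all (fun x => H w x == y x) xs) = u%:R^-1 ^+ size xs.

End Probability.

Section Asymptotics.
Variable R : realType.

Definition log (b x : R) : R := ln x / ln b.

Definition between (lo hi f g : R) : Prop := lo * g <= f <= hi * g.

Definition routing_ratio (p : boa_params) (l : nat) : R :=
  (growth p ^ hlen p l)%:R / (block p * growth p ^ l.-1)%:R.

Record setting (wlo whi ulo uhi k : R) (N : nat) (p : boa_params) : Prop :=
  Setting {
    growth_ge2 : (2 <= growth p)%N;
    growth_leN : (growth p <= N)%N;
    block_gt0 : (0 < block p)%N;
    (* The insertion buffer of B entries and three blocks, as needed by binary
       merging. *)
    memory_ge : ((entry_words p + 3) * block p <= memory p)%N;
    wordbits_Theta : between wlo whi (wordbits p)%:R (log 2 N%:R);
    universe_Theta : between ulo uhi (universe p)%:R (N%:R `^ k)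
  }.

End Asymptotics.

(* Main.v *)
Require Import Defs.
From mathcomp Require Import all_boot all_order all_algebra.
From mathcomp Require Import reals exp.
From mathcomp Require Import zify ring lra.

(* Insertions.  Let n be the number of flushed buffers.  Level l receives a run
   of B lambda^(l-1) entries every lambda^(l-1) flushes.  Each one costs
   O(lambda^(l-1)) IOs for the run and O(1 + lambda^l log lambda / log N) IOs
   for the filter, and every lambda-th one a merge of O(lambda^l) IOs per pass.
   Over the log_lambda N levels this is n times the sum of lambda (filters),
   log_lambda N (runs) and log_lambda N * log_{M/B} lambda = log_{M/B} N
   (merges), and n B <= N.

   Queries.  A run of level l is visited only if it holds a key with the same
   prefix of length h_l as x, and then costs O(1 + load / B) IOs, where the load
   counts its keys with the same prefix of length l - 1.  Let Y be the sum of
   B + load over the visited runs.  Expand Y^m one factor at a time: a factor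
   either falls in a run already visited, where it contributes O(B) in
   expectation plus the keys already met, or opens a new run, for which there is
   O(1) expected choice per level, of expected weight O(B).  Hence
   E[Y^m] <= (B O(m + log_lambda N))^m, and only 2m keys besides x are involved.
   Markov's inequality concludes, with m a multiple of log_lambda N small enough
   for the independence of the hash function. *)

Set Implicit Arguments.
Unset Strict Implicit.
Unset Printing Implicit Defensive.

Import Order.TTheory GRing.Theory Num.Theory.

(** * Costs of the disk layout and of merging *)

(** The interval may cover a block partially at each end, whence two extra blocks. The two lemmas
    below lose only one when the interval starts at a block boundary, and none when its length is
    also a multiple of [u]. *)
Lemma size_spanned u a n : 0 < u -> size (spanned u a n) * u <= n + 2 * u.
Proof.
rewrite /spanned; case: eqP => [|/eqP n0] u0 //=; rewrite size_iota.
by move: (leq_divM a u) (ltn_ceil a u0) (leq_divM (a + n).-1 u); nia.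
Qed.

Lemma size_spanned0 u n : 0 < u -> size (spanned u 0 n) * u <= n + u.
Proof.
rewrite /spanned; case: eqP => [|/eqP n0] u0 //=; rewrite size_iota div0n.
by move: (leq_divM n.-1 u); nia.
Qed.

Lemma size_spanned_mul u k : 0 < u -> size (spanned u 0 (k * u)) = k.
Proof.
rewrite /spanned => u0; case: eqP => [|/eqP n0] /=; first by nia.
rewrite size_iota div0n subn0 add0n.
have k0 : 0 < k by nia.
have -> : (k * u).-1 = k.-1 * u + u.-1 by nia.
by rewrite divnMDl // divn_small ?addn0 ?prednK //; lia.
Qed.

Section Merging.
Variables (p : boa_params) (V : Type).
Hypothesis B_gt0 : 0 < block p.

Definition contents (ts : seq (tape V)) := flatten [seq t.1 | t <- ts].

Lemma contig_iosE n : block p %| n -> contig_ios p n * block p = n * entry_words p.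
Proof.
by case/dvdnP=> k ->; rewrite /contig_ios mulnAC size_spanned_mul // mulnAC.
Qed.

(** Only the multiset of fingerprints is followed through a merge. As [le_fp] compares first
    components alone, merging commutes with [unzip1], and it permutes its inputs whether or not they
    are sorted. *)
Lemma perm_foldr_merge (ss : seq (seq (nat * V))) :
  perm_eq (unzip1 (foldr (merge (@le_fp V)) [::] ss)) (unzip1 (flatten ss)).
Proof.
elim: ss => //= s ss IH.
rewrite /unzip1 map_cat (@map_merge _ _ fst _ leq) // perm_merge perm_cat2l.
exact: IH.
Qed.

Lemma perm_merge_groups (gs : seq (seq (tape V))) :
  perm_eq (unzip1 (flatten [seq foldr (merge (@le_fp V)) [::] [seq t.1 | t <- g] | g <- gs]))
    (unzip1 (contents (flatten gs))).
Proof.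
elim: gs => //= g gs IH; rewrite /unzip1 /contents !map_cat flatten_cat !map_cat.
exact: perm_cat (perm_foldr_merge _) IH.
Qed.

Lemma flatten_chunks f (ts : seq (tape V)) : 0 < f -> flatten (chunks f ts) = ts.
Proof.
move=> f0; apply: reshapeKr; rewrite sumn_nseq /ceil_div.
have := ltn_ceil (size ts + f).-1 f0; nia.
Qed.

(** On such sizes [contig_iosE] is an equality, so that no rounding accumulates over the tapes of a
    pass. *)
Definition aligned (ts : seq (tape V)) := all (fun t => block p %| size t.1) ts.

Lemma aligned_cat ts ts' : aligned (ts ++ ts') = aligned ts && aligned ts'.
Proof. exact: all_cat. Qed.

Lemma size_unzip1 (s : seq (nat * V)) : size (unzip1 s) = size s.
Proof. exact: size_map. Qed.

Lemma aligned_size ts : aligned ts -> block p %| size (contents ts).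
Proof.
elim: ts => [|t ts IH] //= /andP[h1 h2].
by rewrite size_cat dvdn_add // IH.
Qed.

Lemma merge_passP f c c' (ts ts' : seq (tape V)) : 0 < f -> aligned ts ->
  merge_pass p f (c, ts) = (c', ts') ->
  [/\ perm_eq (unzip1 (contents ts')) (unzip1 (contents ts)), aligned ts',
      sumn [seq t.2 | t <- ts'] * block p = size (contents ts') * entry_words p
    & c' = c + sumn [seq t.2 | t <- ts] + sumn [seq t.2 | t <- ts']].
Proof.
move=> f0; rewrite /merge_pass /= -{1}(flatten_chunks ts f0) => al.
case=> <- <-; set outs := [seq contig p _ | _ <- _].
have [alo co] : aligned outs /\
    sumn [seq t.2 | t <- outs] * block p = size (contents outs) * entry_words p.
  rewrite {}/outs; elim: (chunks f ts) al => [|g gs IH] //=.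
  rewrite aligned_cat => /andP[alg /IH [al2 eq2]].
  have dv : block p %| size (foldr (merge (@le_fp V)) [::] [seq t.1 | t <- g]).
    rewrite -size_unzip1 (perm_size (perm_foldr_merge _)) size_unzip1.
    exact: aligned_size alg.
  by rewrite dv al2 mulnDl contig_iosE // eq2 /contents /= size_cat mulnDl.
split=> //.
rewrite -{1}(flatten_chunks ts f0) /outs /contents -map_comp.
exact: perm_merge_groups.
Qed.

(** A pass reads tapes of total cost at most [4 * entry_words p * T], the price of bucketed runs,
    and writes contiguous tapes of cost exactly [entry_words p * T]; hence the constant 5. The
    output satisfies the reading bound again. *)
Lemma merge_tapesP T (ts : seq (tape V)) : 0 < fan_in p -> aligned ts ->
  size (contents ts) = T * block p ->
  sumn [seq t.2 | t <- ts] <= 4 * entry_words p * T ->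
  forall c m, merge_tapes p ts = (c, m) ->
  perm_eq (unzip1 m) (unzip1 (contents ts)) /\
  c <= up_log (fan_in p) (size ts) * (5 * entry_words p * T).
Proof.
move=> f0 al szT cost c m; rewrite /merge_tapes.
set k := up_log _ _.
suff: let: (c, ts') := iter k (merge_pass p (fan_in p)) (0, ts) in
  [/\ perm_eq (unzip1 (contents ts')) (unzip1 (contents ts)), aligned ts',
      sumn [seq t.2 | t <- ts'] <= 4 * entry_words p * T
    & c <= k * (5 * entry_words p * T)].
  by case: (iter _ _ _) => c' ts' [pe _ _ cc] [<- <-].
elim: k {c m} => [|k]; first by split.
rewrite iterS; case: (iter _ _ _) => c ts' [pe al' co' cc].
case E: (merge_pass p (fan_in p) (c, ts')) => [c2 ts2].
have [pe2 al2 co2 ->] := merge_passP f0 al' E.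
have pe3 := perm_trans pe2 pe.
have sz2 : size (contents ts2) = T * block p.
  by rewrite -szT -!size_unzip1 (perm_size pe3).
have e2 : sumn [seq t.2 | t <- ts2] = T * entry_words p.
  by apply/eqP; rewrite -(eqn_pmul2r B_gt0) co2 sz2 mulnAC.
split=> //; rewrite ?e2; lia.
Qed.
End Merging.

Section LayoutCosts.
Variable p : boa_params.
Hypotheses (B_gt0 : 0 < block p) (w_gt0 : 0 < wordbits p).

Lemma entry_words_gt0 : 0 < entry_words p.
Proof. by rewrite /entry_words /ceil_div divn_gt0 //; lia. Qed.

Lemma bucket_blocks_le fps b :
  size (bucket_blocks p fps b) * block p <= (load p fps b).+1 * entry_words p + 2 * block p.
Proof.
apply: leq_trans (size_spanned _ _ B_gt0) _.
by rewrite leq_add2r leq_mul2r geq_minl orbT.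
Qed.

(** Exchanging the sums, each fingerprint is counted in at most one bucket. *)
Lemma sum_load fps n : \sum_(b <- iota 0 n) load p fps b <= size fps.
Proof.
rewrite /load; under eq_bigr do rewrite -sum1_count big_mkcond.
rewrite exchange_big -sum1_size /=; apply: leq_sum => K _.
rewrite -big_mkcond sum1_count.
under eq_count do rewrite eq_sym.
by rewrite (count_uniq_mem _ (iota_uniq _ _)) leq_b1.
Qed.

(** Summed over the [T] buckets, the keys and the end cells fill at most
    [(T * block p + T) * entry_words p] words, and the partial blocks at the ends cost [2 * T] IOs.
    As [block p] and [entry_words p] are positive, this amounts to a factor 4. *)
Lemma run_ios_le fps T : size fps = T * block p ->
  run_ios p fps <= 4 * entry_words p * T.
Proof.
move=> szT; rewrite -(leq_pmul2r B_gt0).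
apply: (@leq_trans (sumn [seq size (bucket_blocks p fps b) | b <- iota 0 T] * block p)).
  rewrite leq_mul2r; apply/orP; right.
  apply: leq_trans (size_undup _) _.
  by rewrite size_flatten /shape -map_comp /nbuckets szT mulnK.
rewrite sumnE big_map big_distrl /=.
apply: (@leq_trans (\sum_(b <- iota 0 T) ((load p fps b).+1 * entry_words p + 2 * block p))).
  by apply: leq_sum => b _; exact: bucket_blocks_le.
have cst c : \sum_(b <- iota 0 T) c = T * c.
  by rewrite big_const_seq count_predT iter_addn_0 size_iota mulnC.
rewrite big_split /= -big_distrl /= cst.
have -> : \sum_(b <- iota 0 T) (load p fps b).+1 = \sum_(b <- iota 0 T) load p fps b + T.
  under eq_bigr do rewrite -addn1.
  by rewrite big_split /= cst muln1.
have := sum_load fps T; have := entry_words_gt0; rewrite szT.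
by move: (\sum_(_ <- _) _) (entry_words p) (block p) B_gt0 => S e B ? ? ?; nia.
Qed.

Hypothesis ratio : forall l, 0 < l -> growth p ^ hlen p l = block p * growth p ^ l.

(** The filter has [block p * growth p ^ l] characters and a block has [block p * wordbits p] bits,
    so [block p] cancels. *)
Lemma filter_ios_le l : 0 < l ->
  filter_ios p l * wordbits p <= growth p ^ l * charbits p + wordbits p.
Proof.
move=> l0; rewrite -(leq_pmul2l B_gt0) mulnCA mulnDr (mulnA _ _ (charbits p)) -ratio //.
by apply: size_spanned0; rewrite muln_gt0 B_gt0.
Qed.

End LayoutCosts.

(** * Shape of the BOA and cost of the insertions *)

Section Skeleton.
Variables (p : boa_params) (T : Type).
Hypotheses (growth_gt1 : 1 < growth p) (B_gt0 : 0 < block p).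

(* The BOA with keys in place of entries.  It shows that the set of keys of each
   run does not depend on the hash function. *)
Fixpoint key_push (klvs : seq (seq (seq T))) (ks : seq T) :=
  if klvs is k :: rest then
    if (size k).+1 < growth p then rcons k ks :: rest
    else [::] :: key_push rest (flatten (rcons k ks))
  else [:: [:: ks]].

Definition key_insert (t : seq T * seq (seq (seq T))) x :=
  let buf := rcons t.1 x in
  if size buf < block p then (buf, t.2) else ([::], key_push t.2 buf).

Definition key_insert_all := foldl key_insert ([::], [::]).

(* The numbers of runs are the base-growth digits of the number of pushes. *)
Fixpoint pushes (klvs : seq (seq (seq T))) :=
  if klvs is k :: rest then size k + growth p * pushes rest else 0.

(* The last clause says that the deepest level holds a run. *)
Fixpoint shaped e (klvs : seq (seq (seq T))) :=
  if klvs is k :: rest then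
    [&& size k < growth p, all (fun r => size r == growth p ^ e * block p) k,
        shaped e.+1 rest & 0 < pushes klvs]
  else true.

Lemma size_flatten_const (ss : seq (seq T)) n :
  all (fun s => size s == n) ss -> size (flatten ss) = size ss * n.
Proof. by elim: ss => //= s ss IH /andP[/eqP sn /IH]; rewrite size_cat sn mulSn => ->. Qed.

(** Merging a full level into the next one is a carry of the base-[growth p] counter. *)
Lemma pushes_push e klvs ks : shaped e klvs -> pushes (key_push klvs ks) = (pushes klvs).+1.
Proof.
elim: klvs e ks => [|k rest IH] e ks /=; first by rewrite muln0.
case/and4P=> sk _ sr _; case: ifP => ltk /=; first by rewrite size_rcons.
by rewrite (IH e.+1) //; nia.
Qed.

Lemma shaped_push e klvs ks : shaped e klvs -> size ks = growth p ^ e * block p ->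
  shaped e (key_push klvs ks).
Proof.
elim: klvs e ks => [|k rest IH] e ks /=; first by move=> _ ->; rewrite eqxx growth_gt1.
case/and4P=> sk ak sr _ sks; case: ifP => ltk /=.
  by rewrite size_rcons ltk all_rcons sks eqxx ak sr.
have szf : size (flatten (rcons k ks)) = growth p ^ e.+1 * block p.
  rewrite (@size_flatten_const _ (growth p ^ e * block p)) ?all_rcons ?sks ?eqxx //.
  by rewrite size_rcons expnS -mulnA; congr (_ * _); lia.
by rewrite ltnW // (pushes_push _ sr) IH //=; nia.
Qed.

(** The leading digit of the counter is nonzero, so a counter with [n.+1] digits is at least
    [growth p ^ n]. *)
Lemma size_shaped e klvs : shaped e klvs -> size klvs <= (trunc_log (growth p) (pushes klvs)).+1.
Proof.
case: klvs => // k rest sh.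
suff: growth p ^ size rest <= pushes (k :: rest) by move/(trunc_log_max growth_gt1).
elim: rest k e sh => [|k' rest IH] k e; case/and4P=> _ _ sr n0 /=; first by rewrite expn0.
by apply: leq_trans (leq_addl _ _); rewrite expnS leq_mul2l (IH k' e.+1) // orbT.
Qed.

Lemma key_insert_allP ks : let t := key_insert_all ks in
  [/\ shaped 0 t.2, size t.1 < block p & pushes t.2 * block p + size t.1 = size ks].
Proof.
elim/last_ind: ks => [|ks x]; first by split.
rewrite /key_insert_all foldl_rcons; case: foldl => buf klvs /= [sh sz num].
rewrite /key_insert size_rcons /=; case: ltnP => szb /=.
  by split; rewrite ?size_rcons // addnS num.
split=> //; first by apply: shaped_push; rewrite // size_rcons expn0; lia.
by rewrite (pushes_push _ sh) size_rcons; lia.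
Qed.

End Skeleton.

(** This makes the runs pairwise disjoint once the inserted keys are distinct. *)
Lemma perm_key_insert_all p (T : eqType) (ks : seq T) :
  perm_eq (flatten (flatten (key_insert_all p ks).2) ++ (key_insert_all p ks).1) ks.
Proof.
have push (klvs : seq (seq (seq T))) r :
    perm_eq (flatten (flatten (key_push p klvs r))) (flatten (flatten klvs) ++ r).
  elim: klvs r => [|k rest IH] r /=; first by rewrite cats0.
  case: ifP => _ /=; rewrite ?(perm_trans (IH _)) // !flatten_cat.
    by rewrite flatten_rcons -!catA perm_cat2l perm_catC.
  by rewrite flatten_rcons perm_sym -catA perm_catCA perm_refl.
elim/last_ind: ks => //= ks x; rewrite /key_insert_all foldl_rcons.
case: foldl => buf klvs /= IH; rewrite /key_insert /=; case: ifP => _ /=.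
  by rewrite -rcons_cat -!cats1 perm_cat2r.
by rewrite cats0 (perm_trans (push _ _)) // -rcons_cat -!cats1 perm_cat2r.
Qed.

(** * Simulation of the BOA by its keys, with amortized cost *)

Section Simulation.
Variables (p : boa_params) (V T : Type) (f : T -> nat).
Hypotheses (growth_gt1 : 1 < growth p) (B_gt0 : 0 < block p) (w_gt0 : 0 < wordbits p).
Hypothesis fan_in_gt0 : 0 < fan_in p.

Definition contains l (lv : level V) j i :=
  (0 < j <= size (runs lv)) &&
  has (fun K => Defs.prefix p (hlen p l) K == i) (fps (nth [::] (runs lv) j.-1)).

(** Soundness of the routing data: a pointer of the filter or of an entry leads to a run that holds
    the prefix, and a previous field never leads to a newer run. The run at position [j] of the
    sequence has index [j.+1]. *)
Definition chained l (lv : level V) :=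
  (forall i, Defs.filter lv i != 0 -> contains l lv (Defs.filter lv i) i) /\
  (forall j, all (fun e => (previous e <= j.+1) &&
                contains l lv (previous e) (Defs.prefix p (hlen p l) (fp e)))
             (nth [::] (runs lv) j)).

(** A permutation, since a run is sorted by fingerprint while the skeleton keeps keys in order of
    arrival. *)
Definition same_fps (r : seq (entry V)) (k : seq T) := perm_eq (fps r) (map f k).

Fixpoint simulates e (lvs : seq (level V)) (klvs : seq (seq (seq T))) : Prop :=
  match lvs, klvs with
  | [::], [::] => True
  | lv :: rest, k :: krest =>
      [/\ all2 same_fps (runs lv) k, chained e.+1 lv & simulates e.+1 rest krest]
  | _, _ => False
  end.

Lemma chained_empty l : chained l (empty_level V).
Proof. by split=> // j; rewrite nth_nil. Qed.

Lemma chained_install l lv s : chained l lv -> chained l (install p l lv s).2.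
Proof.
pose pre := Defs.prefix p (hlen p l); rewrite /install.
set j := (size _).+1; set run := [seq _ | x <- s].
set lv' := Level _ _ => -[filterP prevP] /=; rewrite -/lv'.
have sub j' i : contains l lv j' i -> contains l lv' j' i.
  case/andP=> /andP[j'0 j's] hasj'; rewrite /contains /= size_rcons j'0 leqW //=.
  by rewrite nth_rcons prednK // j's.
have new i : has (fun x => pre x.1 == i) s -> contains l lv' j i.
  move=> hasi; rewrite /contains /= size_rcons leqnn nth_rcons ltnn eqxx.
  rewrite /fps -map_comp has_map; exact: hasi.
split=> [i /=|j' /=]; first by case: ifP => [/new//|_ /filterP/sub].
rewrite nth_rcons; case: ltnP => j's; last case: eqP => // ->.
  apply: sub_all (prevP j') => e /andP[-> c]; exact: sub.
(* The new run holds the prefix of each of its own entries, so an entry may point to its own run [j]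
   when the filter was 0 there. *)
have self : all (fun x => has (fun y => pre y.1 == pre x.1) s) s.
  have: all (fun i => i \in [seq pre x.1 | x <- s]) [seq pre x.1 | x <- s] by apply/allP.
  rewrite all_map; apply: sub_all => x /=; rewrite -has_pred1 has_map.
  by apply: sub_has => y /=; rewrite eq_sym.
rewrite all_map; apply: sub_all self => x hasx /=.
case: ifPn => [_|fn0]; first by rewrite leqnn; exact: new.
have c := filterP _ fn0; rewrite sub // andbT.
by case/andP: c => /andP[_ /leqW].
Qed.

(** Two contiguous scans and one bucketed write, of relative costs 1, 1 and 4; the filter is read,
    rewritten and, on a new level, initialized. *)
Definition install_bound e := 6 * entry_words p * growth p ^ e + 3 * filter_ios p e.+1.

Definition merge_bound e :=
  up_log (fan_in p) (growth p) * (5 * entry_words p * growth p ^ e.+1) + filter_ios p e.+1.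

(* Upper bound on the cost of n pushes to the level e.+1: every push installs
   a run, every growth-th push instead merges the level into the next one. *)
Fixpoint pushes_bound D e n :=
  n * install_bound e +
  if D is D'.+1 then
    n %/ growth p * merge_bound e + pushes_bound D' e.+1 (n %/ growth p)
  else 0.

Lemma pushes_bound_ge D e n : n * install_bound e <= pushes_bound D e n.
Proof. by case: D => [|D] /=; rewrite leq_addr. Qed.

Lemma pushes_bound0 D e : pushes_bound D e 0 = 0.
Proof. by elim: D e => [|D IH] e //=; rewrite div0n IH. Qed.

Lemma install_cost e (lv : level V) s k : perm_eq (unzip1 s) (map f k) ->
  size k = growth p ^ e * block p ->
  (install p e.+1 lv s).1 + filter_ios p e.+1 <= install_bound e.
Proof.
move=> pe szk; rewrite /install /install_bound /=.
have szs : size s = growth p ^ e * block p.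
  by have := perm_size pe; rewrite !size_map szk.
have c : contig_ios p (size s) = growth p ^ e * entry_words p.
  apply/eqP; rewrite -(eqn_pmul2r B_gt0) contig_iosE ?szs ?dvdn_mull //.
  by rewrite mulnAC.
set r := run_ios _ _; have: r <= 4 * entry_words p * growth p ^ e.
  by apply: run_ios_le => //; rewrite !size_map szs.
by rewrite c; lia.
Qed.

Lemma all2_rcons {A B : Type} (P : A -> B -> bool) s t x y :
  all2 P s t -> P x y -> all2 P (rcons s x) (rcons t y).
Proof. by elim: s t => [|a s IH] [|b t] //=; [move=> _ -> | case/andP=> -> /IH]. Qed.

Lemma all2_size {A B : Type} (P : A -> B -> bool) s t : all2 P s t -> size s = size t.
Proof. by elim: s t => [|a s IH] [|b t] //= /andP[_ /IH ->]. Qed.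

Lemma install_runs l lv s k ks : all2 same_fps (runs lv) k -> perm_eq (unzip1 s) (map f ks) ->
  all2 same_fps (runs (install p l lv s).2) (rcons k ks).
Proof.
move=> a pe; apply: all2_rcons a _.
by rewrite /same_fps /fps -map_comp.
Qed.

Lemma merge_level_cost e lv k s ks c m :
  all2 same_fps (runs lv) k -> all (fun r => size r == growth p ^ e * block p) k ->
  (size k).+1 = growth p ->
  perm_eq (unzip1 s) (map f ks) -> size ks = growth p ^ e * block p ->
  merge_tapes p (rcons [seq (unpack r, run_ios p (fps r)) | r <- runs lv] (contig p s)) = (c, m) ->
  perm_eq (unzip1 m) (map f (flatten (rcons k ks))) /\
  c + filter_ios p e.+1 <= merge_bound e.
Proof.
move=> a szk sk pe szks.
have szs : size s = growth p ^ e * block p.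
  by have := perm_size pe; rewrite !size_map szks.
set ts := rcons _ _.
have szf : size (flatten (rcons k ks)) = growth p ^ e.+1 * block p.
  rewrite (@size_flatten_const _ _ (growth p ^ e * block p)) ?all_rcons ?szks ?eqxx //.
  by rewrite size_rcons expnS -mulnA sk.
have [al pet co] : [/\ aligned p ts, perm_eq (unzip1 (contents ts)) (map f (flatten (rcons k ks)))
    & sumn [seq t.2 | t <- ts] <= 4 * entry_words p * growth p ^ e * (size k).+1].
  rewrite {}/ts {sk szf}; elim: (runs lv) k a szk => [|r rs IH] [|k0 k] //=.
    move=> _ _; rewrite szs dvdn_mull // cats0 /contents /= cats0 /unzip1 pe.
    split=> //; have := @contig_iosE p B_gt0 (size s); rewrite szs dvdn_mull // => /(_ isT).
    rewrite mulnAC => /eqP; rewrite eqn_pmul2r // => /eqP ->; lia.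
  case/andP=> sr a /andP[/eqP szk0 szk]; have [al pet co] := IH _ a szk.
  have szr : size r = growth p ^ e * block p.
    by have := perm_size sr; rewrite !size_map szk0.
  rewrite al /unpack !size_map szr dvdn_mull //=; split=> //.
    rewrite /contents /= /unzip1 !map_cat -map_comp; exact: perm_cat sr pet.
  rewrite mulnS leq_add // run_ios_le // size_map; lia.
have szts : size ts = growth p by rewrite size_rcons size_map (all2_size a).
move=> /(merge_tapesP B_gt0 fan_in_gt0 al (T := growth p ^ e.+1)).
have sc : size (contents ts) = growth p ^ e.+1 * block p.
  by rewrite -size_unzip1 (perm_size pet) size_map.
case/(_ sc) => [|pem].
  by apply: leq_trans co _; rewrite sk expnS; lia.
by rewrite szts => cc; split; [exact: perm_trans pem pet | rewrite leq_add2r].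
Qed.

Lemma push_cons l lv rest s : push p l (lv :: rest) s =
  if (size (runs lv)).+1 < growth p then
    ((install p l lv s).1, (install p l lv s).2 :: rest)
  else
    let cm := merge_tapes p
      (rcons [seq (unpack r, run_ios p (fps r)) | r <- runs lv] (contig p s)) in
    let cr := push p l.+1 rest cm.2 in
    (cm.1 + filter_ios p l + cr.1, empty_level V :: cr.2).
Proof.
move=> /=; case: ifP => // _; case: (merge_tapes _ _) => c m.
by rewrite -/(@push p V) /=; case: (push _ _ _ _).
Qed.

(** [pushes_bound] of the counter is a potential whose increment pays for the push. If the level is
    not full, the quotient by [growth p] is unchanged and one installation is paid. Otherwise the
    quotient grows by one, which pays for the merge and, inductively, for the push to the next
    level. *)
Lemma push_simulates e lvs klvs s ks c lvs' :
  simulates e lvs klvs -> shaped p e klvs ->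
  perm_eq (unzip1 s) (map f ks) -> size ks = growth p ^ e * block p ->
  push p e.+1 lvs s = (c, lvs') ->
  simulates e lvs' (key_push p klvs ks) /\
  forall D, size klvs <= D ->
    c + pushes_bound D e (pushes p klvs) <= pushes_bound D e (pushes p klvs).+1.
Proof.
elim: lvs klvs e s ks c lvs' => [|lv rest IH] [|k krest] e s ks c lvs' //.
  move=> _ _ pe szks [<- <-]; split=> [|D _].
    split=> //; first exact: (@install_runs e.+1 (empty_level V) s [::] ks isT pe).
    exact: chained_install (chained_empty _).
  rewrite pushes_bound0 addn0; apply: leq_trans (pushes_bound_ge _ _ _).
  by rewrite mul1n addnC; exact: (@install_cost e (empty_level V) s ks pe szks).
move=> [a ch sim] /and4P[ltk ak shr n0] pe szks.
rewrite push_cons (all2_size a) [key_push _ _ _]/=; case: ifP => lt.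
  case=> <- <-; split=> [|[|D] // leD].
    split=> //; first exact: (@install_runs e.+1 lv s k ks a pe).
    exact: (@chained_install e.+1 lv s ch).
  have /= c0le := @install_cost e lv s ks pe szks.
  have dv n : n < growth p -> (n + growth p * pushes p krest) %/ growth p = pushes p krest.
    by move=> nlt; rewrite addnC mulnC divnMDl ?divn_small ?addn0 //; lia.
  by rewrite -addSn !dv //; lia.
rewrite /=; case E: (merge_tapes _ _) => [c1 m] /=.
case E': (push p e.+2 rest m) => [c2 rest'] [<- <-].
have sk : (size k).+1 = growth p by apply/eqP; rewrite eqn_leq ltk leqNgt lt.
have [pem cm] := merge_level_cost a ak sk pe szks E.
have szm : size (flatten (rcons k ks)) = growth p ^ e.+1 * block p.
  rewrite (@size_flatten_const _ _ (growth p ^ e * block p)) ?all_rcons ?szks ?eqxx //.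
  by rewrite size_rcons expnS -mulnA sk.
have [sim' cost'] := IH _ _ _ _ _ _ sim shr pem szm E'.
split=> [|[|D] // leD]; first by split=> //; exact: chained_empty.
rewrite /=; have -> : (size k + growth p * pushes p krest) %/ growth p = pushes p krest.
  by rewrite addnC mulnC divnMDl ?divn_small ?addn0 //; lia.
have -> : (size k + growth p * pushes p krest).+1 %/ growth p = (pushes p krest).+1.
  by rewrite -addSn sk -mulnS mulKn //; lia.
have := cost' D leD; lia.
Qed.

(** The term [pushes p kt.2 * entry_words p] pays for writing each full buffer to disk as a sorted
    array; the potential pays for the rest. *)
Lemma insert_allP D N (xs : seq (nat * V)) (ks : seq T) :
  unzip1 xs = map f ks -> size xs <= N -> trunc_log (growth p) N < D ->
  let: (c, t) := insert_all p xs in let kt := key_insert_all p ks in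
  [/\ simulates 0 (levels t) kt.2, unzip1 (buffer t) = map f kt.1
    & c <= pushes p kt.2 * entry_words p + pushes_bound D 0 (pushes p kt.2)].
Proof.
move=> eqk szN logD; elim/last_ind: xs ks eqk szN => [|xs x IH] ks.
  by case: ks => // _ _; split.
case/lastP: ks => [|ks k]; rewrite /unzip1 ?map_rcons.
  by move/(congr1 size); rewrite size_rcons.
move=> eqk; have [eqks eqx] : unzip1 xs = map f ks /\ x.1 = f k.
  by move: eqk => /rcons_inj[].
rewrite size_rcons => szN; have := IH ks eqks (ltnW szN).
rewrite /insert_all /key_insert_all !foldl_rcons.
have := key_insert_allP growth_gt1 B_gt0 ks; rewrite /key_insert_all.
case: (foldl _ ([::], [::]) ks) => kbuf klvs /= [sh szb num].
case: (foldl _ _ xs) => c [buf lvs] /= [sim eqb cost].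
have szbuf : size buf = size kbuf by have := congr1 size eqb; rewrite !size_map.
rewrite /insert /key_insert /= !size_rcons szbuf; case: ltnP => ltB /=.
  by split; rewrite ?map_rcons ?eqx ?addn0 //; congr rcons.
set s := sort _ _; case E: (push p 1 lvs s) => [c' lvs'] /=.
have pes : perm_eq (unzip1 s) (map f (rcons kbuf k)).
  rewrite /s /unzip1 (@map_sort _ _ fst _ leq) // perm_sort map_rcons eqx map_rcons.
  by move: eqb; rewrite /unzip1 => ->.
have szks : size (rcons kbuf k) = growth p ^ 0 * block p by rewrite size_rcons expn0; lia.
have [sim' cost'] := push_simulates sim sh pes szks E.
split=> //.
have -> : contig_ios p (size s) = entry_words p.
  have -> : size s = 1 * block p.
    by have := perm_size pes; rewrite !size_map szks.
  by rewrite /contig_ios mul1n mulnC size_spanned_mul.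
rewrite (pushes_push growth_gt1 B_gt0 _ sh).
(* The depth [D] of the potential must cover all levels, whose number is logarithmic in the number
   of pushes. *)
suff: size klvs <= D by move/cost'; lia.
apply: leq_trans (size_shaped growth_gt1 sh) _; apply: leq_trans logD.
rewrite ltnS leq_trunc_log //.
have : size ks <= N by have := congr1 size eqks; rewrite !size_map; lia.
by rewrite -num; nia.
Qed.

End Simulation.

(** * Sum of the amortized bound over the levels *)

Section PushesBound.
Variable p : boa_params.
Hypotheses (growth_gt1 : 1 < growth p) (B_gt0 : 0 < block p) (w_gt0 : 0 < wordbits p).
Hypothesis ratio : forall l, 0 < l -> growth p ^ hlen p l = block p * growth p ^ l.

(** The charge of one level per flushed buffer, scaled by [wordbits p] to remain an integer. The two
    constants 4 collect the three filter scans of an installation and the one of a merge. *)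
Definition level_bound :=
  wordbits p * (6 * entry_words p
                + 5 * entry_words p * up_log (fan_in p) (growth p) + 4)
  + 4 * growth p * charbits p.

Lemma filter_share e n X : n * growth p ^ e <= X ->
  n * filter_ios p e.+1 * wordbits p <= X * (growth p * charbits p + wordbits p).
Proof.
move=> nX; rewrite -mulnA; have := filter_ios_le B_gt0 w_gt0 ratio (ltn0Sn e).
rewrite expnS => /(leq_mul (leqnn n))/leq_trans; apply.
have gn : n <= X by apply: leq_trans nX; rewrite leq_pmulr // expn_gt0 ltnW.
have := leq_mul nX (leqnn (growth p * charbits p)); have := leq_mul gn (leqnn (wordbits p)).
lia.
Qed.

(** The quantity [n * growth p ^ e], a number of flushed buffers, does not increase from one level
    to the next, so each of the [D.+1] levels is charged the same amount. *)
Lemma pushes_bound_le D e n X : n * growth p ^ e <= X ->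
  pushes_bound p D e n * wordbits p <= D.+1 * X * level_bound.
Proof.
have inst e' n' : n' * growth p ^ e' <= X ->
  n' * install_bound p e' * wordbits p
  <= X * (wordbits p * (6 * entry_words p + 3) + 3 * growth p * charbits p).
  move=> nX; have := filter_share nX; rewrite /install_bound.
  have := leq_mul nX (leqnn (6 * entry_words p * wordbits p)); lia.
have merge e' n' : n' * growth p ^ e'.+1 <= X ->
  n' * merge_bound p e' * wordbits p
  <= X * (wordbits p * (5 * entry_words p * up_log (fan_in p) (growth p) + 1)
          + growth p * charbits p).
  move=> nX; have nX' : n' * growth p ^ e' <= X.
    by apply: leq_trans nX; rewrite leq_mul2l leq_pexp2l ?orbT // ltnW.
  have := filter_share nX'; rewrite /merge_bound.
  have := leq_mul nX (leqnn (up_log (fan_in p) (growth p) * 5 * entry_words p * wordbits p)).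
  lia.
elim: D e n => [|D IH] e n nX /=.
  by rewrite addn0 mul1n; apply: leq_trans (inst _ _ nX) _; rewrite /level_bound; lia.
have nX' : n %/ growth p * growth p ^ e.+1 <= X.
  by apply: leq_trans nX; rewrite expnS mulnA leq_mul2r leq_divM orbT.
have := inst _ _ nX; have := merge _ _ nX'; have := IH _ _ nX'.
rewrite /level_bound; lia.
Qed.

Lemma insertion_ios_le (T V : Type) (hash : T -> 'I_(universe p)) (s : seq (T * V)) :
  0 < fan_in p ->
  insertion_ios hash s * wordbits p * block p <=
  size s * (entry_words p * wordbits p
            + (trunc_log (growth p) (size s)).+2 * level_bound).
Proof.
move=> f0; set D := (trunc_log (growth p) (size s)).+1.
pose f x : nat := hash x.
have eqk : unzip1 (hashed hash s) = map f (unzip1 s) by rewrite /unzip1 /hashed -!map_comp.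
have szs : size (hashed hash s) <= size s by rewrite size_map.
have := insert_allP growth_gt1 B_gt0 w_gt0 f0 eqk szs (ltnSn _ : _ < D).
rewrite /insertion_ios; case: (insert_all _ _) => c t [_ _ /= cost].
have [_ _] := key_insert_allP growth_gt1 B_gt0 (unzip1 s); rewrite size_map.
move: (pushes _ _) cost => n cost num.
have nB : n * block p <= size s by lia.
have := @pushes_bound_le D 0 n n; rewrite expn0 muln1 => /(_ (leqnn n)) pb.
apply: (@leq_trans ((n * entry_words p + pushes_bound p D 0 n) * wordbits p * block p)).
  by rewrite !leq_mul.
apply: leq_trans (leq_mul nB (leqnn _)).
have := leq_mul pb (leqnn (block p)); lia.
Qed.
End PushesBound.

(** * Cost of a query *)

Section QueryCost.
Variables (p : boa_params) (V T : Type) (f : T -> nat).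
Hypotheses (growth_gt1 : 1 < growth p) (B_gt0 : 0 < block p) (w_gt0 : 0 < wordbits p).
Implicit Types (lv : level V) (K : nat).

Definition matches h K := fun K' => Defs.prefix p h K' == Defs.prefix p h K.

Definition bucket_ios (r : seq (entry V)) K :=
  size (bucket_blocks p (fps r) (bucket p (fps r) K)).

Lemma ohead_filter (S : Type) (A : Type) (P Q : pred A) (g : A -> S) s j :
  all P s -> ohead [seq g e | e <- s & Q e] = Some j -> exists2 e, P e && Q e & g e = j.
Proof.
elim: s => //= e s IH /andP[Pe Ps]; case: ifP => [Qe [<-]|_]; last exact: IH.
by exists e; rewrite ?Pe.
Qed.

Lemma sum_ord_le (F : nat -> nat) m n : m <= n -> \sum_(i < m) F i <= \sum_(i < n) F i.
Proof.
by move=> mn; rewrite -!(big_mkord xpredT F) [leqRHS](big_cat_nat (leq0n _) mn) /= leq_addr.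
Qed.

(** The run indices strictly decrease along the chain, so no run is charged twice, and by [chained]
    each visited run holds the prefix. *)
Lemma chase_le n l lv K j : chained p l lv ->
  j = 0 \/ contains p l lv j (Defs.prefix p (hlen p l) K) ->
  (chase p n l lv K j).1 <=
  \sum_(i < j) has (matches (hlen p l) K) (fps (nth [::] (runs lv) i))
               * bucket_ios (nth [::] (runs lv) i) K.
Proof.
move=> [filterP prevP]; elim: n j => [|n IH] [|j] // [//|cj] /=.
rewrite big_ord_recr /=; case/andP: (cj) => /andP[_ js] /= hasj.
rewrite /matches hasj mul1n -/(bucket_ios _ _).
case E: ohead => [j'|]; last by rewrite leq_addl.
case: eqP => [_|/eqP jj]; first by rewrite leq_addl.
have [e] := ohead_filter (prevP j) E.
case/andP=> /andP[le_ej ce] /eqP same def_j'.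
rewrite same def_j' in ce le_ej.
have := IH j' (or_intror ce); case: (chase _ _ _ _ _ _) => c' vs /= le_c'.
rewrite addnC leq_add2r; apply: leq_trans le_c' _.
have j'j : j' <= j by rewrite -ltnS ltn_neqAle jj.
exact: (sum_ord_le (fun i => has (matches (hlen p l) K) (fps (nth [::] (runs lv) i))
               * bucket_ios (nth [::] (runs lv) i) K)).
Qed.

(** The tag of a run is its level number minus one, which is also the prefix length that determines
    its buckets. *)
Fixpoint runs_from e (klvs : seq (seq (seq T))) : seq (nat * seq T) :=
  if klvs is k :: rest then [seq (e, r) | r <- k] ++ runs_from e.+1 rest else [::].

(** Up to the factor [3 * entry_words p], a bound on [block p] times the cost of the look-up,
    charged only to runs that hold the routing prefix. *)
Definition run_weight K (er : nat * seq T) :=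
  has (fun y => matches (hlen p er.1.+1) K (f y)) er.2
  * (block p + count (fun y => matches er.1 K (f y)) er.2).

(** Such a run has [growth p ^ e] buckets of equal width, so a bucket number consists of the first
    [e] characters. *)
Lemma bucket_prefix e (fps : seq nat) K : e <= fplen p -> size fps = growth p ^ e * block p ->
  bucket p fps K = Defs.prefix p e K.
Proof.
move=> eL szf; rewrite /bucket /nbuckets szf mulnK // /Defs.prefix /universe.
have g0 n : 0 < growth p ^ n by rewrite expn_gt0 ltnW.
by rewrite -{1}(subnK eL) expnD divnMr.
Qed.

Lemma bucket_ios_le e (r : seq (entry V)) k K : e <= fplen p ->
  same_fps f r k -> size k = growth p ^ e * block p ->
  has (matches (hlen p e.+1) K) (fps r) * bucket_ios r K * block p
  <= 3 * entry_words p * run_weight K (e, k).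
Proof.
move=> eL sr szk; rewrite /run_weight /=.
have -> : has (matches (hlen p e.+1) K) (fps r) =
          has (fun y => matches (hlen p e.+1) K (f y)) k by rewrite (perm_has _ sr) has_map.
case: (has _ _) => /=; rewrite ?mul0n // !mul1n.
have szr : size (fps r) = growth p ^ e * block p by rewrite (perm_size sr) size_map.
apply: leq_trans (bucket_blocks_le B_gt0 _ _) _.
have -> : load p (fps r) (bucket p (fps r) K) = count (fun y => matches e K (f y)) k.
  have /permP perm := sr; rewrite /load perm count_map.
  by apply: eq_count => y /=; rewrite !(@bucket_prefix e).
have := entry_words_gt0 B_gt0 w_gt0.
by move: (count _ _) (entry_words p) (block p) B_gt0 => c ew B ? ?; nia.
Qed.

Lemma filter_char_ios_le F i : charbits p <= F * wordbits p -> filter_char_ios p i <= F + 2.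
Proof.
move=> cb; have u0 : 0 < block p * wordbits p by rewrite muln_gt0 B_gt0.
rewrite -(leq_pmul2r u0); apply: leq_trans (size_spanned _ _ u0) _.
by rewrite mulnDl leq_add2r (leq_trans cb) // leq_mul2l leq_pmull ?orbT.
Qed.

Lemma query_levels_le F e (lvs : seq (level V)) klvs K : charbits p <= F * wordbits p ->
  simulates p f e lvs klvs -> shaped p e klvs -> e + size klvs <= (fplen p).+1 ->
  (query_levels p e.+1 lvs K).1 * block p
  <= size klvs * (F + 2) * block p
     + 3 * entry_words p * \sum_(er <- runs_from e klvs) run_weight K er.
Proof.
move=> cb; elim: lvs e klvs => [|lv rest IH] e [|k krest] //=.
move=> [a ch sim] /and4P[ltk ak shr _] le_L.
have {IH} := IH _ _ sim shr; rewrite addSnnS => /(_ le_L).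
set i := Defs.prefix _ _ _; have fc := filter_char_ios_le i cb.
have : (chase p (size (runs lv)) e.+1 lv K (Defs.filter lv i)).1 * block p
   <= 3 * entry_words p * \sum_(er <- [seq (e, r) | r <- k]) run_weight K er.
  have co : Defs.filter lv i = 0 \/ contains p e.+1 lv (Defs.filter lv i) i.
    by case: (eqVneq (Defs.filter lv i) 0) => [->|/(ch.1 _)]; [left|right].
  have le_s : Defs.filter lv i <= size (runs lv).
    by case: co => [->//|/andP[/andP[_]]].
  apply: (@leq_trans (\sum_(r <- runs lv)
      has (matches (hlen p e.+1) K) (fps r) * bucket_ios r K * block p)).
    rewrite -big_distrl /= leq_mul2r; apply/orP; right.
    apply: leq_trans (chase_le _ ch co) _.
    rewrite [leqRHS](big_nth [::]) big_mkord.
    exact: (sum_ord_le (fun i => has (matches (hlen p e.+1) K) (fps (nth [::] (runs lv) i))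
               * bucket_ios (nth [::] (runs lv) i) K)).
  have eL : e <= fplen p by lia.
  rewrite big_map big_distrr /=.
  elim: (runs lv) k a ak {ltk} => [|r rs IH] [|k0 k] //=; first by rewrite !big_nil.
  case/andP=> sr a /andP[/eqP szk0 ak]; rewrite !big_cons leq_add ?IH //.
  exact: bucket_ios_le.
case: (chase _ _ _ _ _ _) => c vs /=.
case: (query_levels _ _ _ _) => c' vs' /=; rewrite big_cat /=.
move: fc; set S1 := \sum_(_ <- _) _; set S2 := \sum_(_ <- _) _.
nia.
Qed.

End QueryCost.

Section Runs.
Variables (p : boa_params).
Hypotheses (growth_gt1 : 1 < growth p) (B_gt0 : 0 < block p).

Lemma runs_fromP (T : Type) e (klvs : seq (seq (seq T))) : shaped p e klvs ->
  all (fun er => (er.1 < e + size klvs) && (size er.2 == growth p ^ er.1 * block p))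
      (runs_from e klvs)
  /\ size (runs_from e klvs) <= growth p * size klvs.
Proof.
elim: klvs e => [|k rest IH] e //=; case/and4P=> ltk ak shr _.
have [IH1 IH2] := IH _ shr; rewrite all_cat size_cat size_map; split; last by lia.
apply/andP; split; last by apply: sub_all IH1 => er; rewrite addSnnS.
by rewrite all_map; apply: sub_all ak => r /= ->; rewrite andbT; lia.
Qed.

Lemma flatten_runs_from (T : Type) e (klvs : seq (seq (seq T))) :
  flatten (unzip2 (runs_from e klvs)) = flatten (flatten klvs).
Proof.
elim: klvs e => //= k rest IH e; rewrite /unzip2 map_cat !flatten_cat -map_comp map_id.
by rewrite -/unzip2 IH.
Qed.

Lemma query_ios_le (Key V : Type) (hash : Key -> 'I_(universe p)) (s : seq (Key * V)) x F :
  let klvs := (key_insert_all p (unzip1 s)).2 in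
  0 < wordbits p -> 0 < fan_in p -> charbits p <= F * wordbits p -> size klvs <= (fplen p).+1 ->
  query_ios hash s x * block p
  <= size klvs * (F + 2) * block p
     + 3 * entry_words p *
       \sum_(er <- runs_from 0 klvs) run_weight p (fun y => hash y) (hash x) er.
Proof.
move=> klvs w_gt0 f0 cb sL.
pose f y : nat := hash y.
have eqk : unzip1 (hashed hash s) = map f (unzip1 s) by rewrite /unzip1 /hashed -!map_comp.
have := insert_allP growth_gt1 B_gt0 w_gt0 f0 eqk (leqnn _) (ltnSn _).
rewrite /query_ios; case: (insert_all _ _) => c t [sim _ _] /=.
have [sh _ _] := key_insert_allP growth_gt1 B_gt0 (unzip1 s).
have := query_levels_le growth_gt1 B_gt0 w_gt0 (hash x) cb sim sh sL.
by rewrite /query; case: (query_levels _ _ _ _).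
Qed.

Lemma key_levels_le (T : Type) (ks : seq T) N : size ks <= N ->
  let klvs := (key_insert_all p ks).2 in
  size klvs <= (trunc_log (growth p) N).+1 /\
  forall e, e < size klvs -> growth p ^ e * block p <= N.
Proof.
move=> szN klvs; have [sh _ num] := key_insert_allP growth_gt1 B_gt0 ks.
have ssh := size_shaped growth_gt1 sh.
have le_N : pushes p klvs * block p <= N by rewrite -/klvs in num; lia.
split=> [|e e_lt].
  by apply: leq_trans ssh _; rewrite ltnS leq_trunc_log // (leq_trans _ le_N) // leq_pmulr.
apply: leq_trans le_N; rewrite leq_mul2r; apply/orP; right.
have pos : 0 < pushes p klvs by move: e_lt sh; rewrite -/klvs; case: klvs => //= k r _ /and4P[].
apply: leq_trans (trunc_logP growth_gt1 pos).
by rewrite leq_pexp2l ?(ltnW growth_gt1) // -ltnS (leq_trans e_lt).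
Qed.

End Runs.

Lemma uniq_flatten_inj (T : eqType) (ss : seq (seq T)) i j y : uniq (flatten ss) ->
  y \in nth [::] ss i -> y \in nth [::] ss j -> i = j.
Proof.
elim: ss i j => [|s ss IH] i j /=; first by rewrite nth_nil.
rewrite cat_uniq => /and3P[_ /hasPn disj us].
have sub k : y \in nth [::] ss k -> y \in flatten ss.
  case: (ltnP k (size ss)) => sk; last by rewrite nth_default.
  by move=> yk; apply/flattenP; exists (nth [::] ss k); rewrite ?mem_nth.
case: i j => [|i] [|j] //=.
- by move=> ys /sub/disj; rewrite /= ys.
- by move=> /sub/disj /negP nys /nys.
- by move=> yi yj; rewrite (IH i j us yi yj).
Qed.

Local Open Scope ring_scope.

(** * Real bounds *)

Section Logs.
Variable R : realType.
Implicit Types (b x y : R) (m n : nat).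

Lemma log_ge0 b x : 1 <= b -> 1 <= x -> 0 <= log b x.
Proof. by move=> b1 x1; apply: divr_ge0; apply: ln_ge0. Qed.

Lemma ln_nat_ge0 n : 0 <= ln n%:R :> R.
Proof. by case: n => [|n]; [rewrite ln0 | rewrite ln_ge0 ?ler1n]. Qed.

Lemma ln_nat_gt0 n : (1 < n)%N -> 0 < ln n%:R :> R.
Proof. by move=> n1; rewrite ln_gt0 // ltr1n. Qed.

Lemma le_ln x y : 0 < x -> x <= y -> ln x <= ln y.
Proof. by move=> x0 xy; rewrite ler_ln ?posrE // (lt_le_trans x0). Qed.

Lemma trunc_log_le_log m n : (1 < m)%N -> (0 < n)%N ->
  (trunc_log m n)%:R <= log m%:R n%:R :> R.
Proof.
move=> m1 n0; rewrite /log ler_pdivlMr ?ln_nat_gt0 // mulr_natl -lnXn ?ltr0n 1?ltnW //.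
by rewrite -natrX le_ln ?ltr0n ?expn_gt0 1?ltnW // ler_nat trunc_logP.
Qed.

Lemma log_le_trunc_log m n : (1 < m)%N -> (0 < n)%N ->
  log m%:R n%:R <= (trunc_log m n).+1%:R :> R.
Proof.
move=> m1 n0; rewrite /log ler_pdivrMr ?ln_nat_gt0 // mulr_natl -lnXn ?ltr0n 1?ltnW //.
by rewrite -natrX le_ln ?ltr0n // ler_nat ltnW // trunc_log_ltn.
Qed.

Lemma up_log_le_log m n : (1 < m)%N -> (0 < n)%N ->
  (up_log m n)%:R <= log m%:R n%:R + 1 :> R.
Proof.
move=> m1; case: n => [|[|n]] // _; first by rewrite up_log1 addr_ge0 // log_ge0 // ler1n ltnW.
rewrite up_log_trunc_log // -natr1 lerD2r (le_trans (trunc_log_le_log m1 _)) //.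
by rewrite ler_wpM2r ?invr_ge0 ?ln_nat_ge0 // le_ln ?ltr0n // ler_nat.
Qed.

Lemma log2_ge1 n : (1 < n)%N -> 1 <= log 2 n%:R :> R.
Proof.
by move=> n1; rewrite ler_pdivlMr ?ln_nat_gt0 // mul1r le_ln ?ltr0n // ler_nat.
Qed.
End Logs.

Section SettingFacts.
Variables (R : realType) (wlo whi ulo uhi k : R).
Variables (N : nat) (p : boa_params).
Hypothesis stg : setting wlo whi ulo uhi k N p.

Lemma N_ge2 : (1 < N)%N.
Proof. exact: leq_trans (growth_ge2 stg) (growth_leN stg). Qed.

Lemma wordbits_ge : wlo * log 2 N%:R <= (wordbits p)%:R.
Proof. by case/andP: (wordbits_Theta stg). Qed.

Lemma fan_in_ge2 : (1 < fan_in p)%N.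
Proof.
have := memory_ge stg; rewrite -leq_divRL ?(block_gt0 stg) // /fan_in; lia.
Qed.

Lemma charbits_le : (charbits p)%:R <= 2 * log 2 (growth p)%:R :> R.
Proof.
apply: le_trans (up_log_le_log R _ _) _ => //; first exact: ltnW (growth_ge2 stg).
by rewrite mulr2n mulrDl !mul1r lerD2l log2_ge1 // (growth_ge2 stg).
Qed.

Lemma growth_power l : (forall l, (0 < l)%N -> routing_ratio R p l = (growth p)%:R) ->
  (0 < l)%N -> (growth p ^ hlen p l = block p * growth p ^ l)%N.
Proof.
move=> ratio l0; have g0 : (0 < growth p)%N by apply: ltnW (growth_ge2 stg).
have := ratio l l0; rewrite /routing_ratio.
have n0 : (block p * growth p ^ l.-1)%:R != 0 :> R.
  by rewrite pnatr_eq0 -lt0n muln_gt0 (block_gt0 stg) expn_gt0 g0.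
move/(congr1 ( *%R^~ (block p * growth p ^ l.-1)%:R)); rewrite /= divfK //.
rewrite -natrM => /eqP; rewrite eqr_nat => /eqP ->.
by rewrite mulnCA -expnS prednK.
Qed.

Hypotheses (wlo_gt0 : 0 < wlo) (uhi_gt0 : 0 < uhi) (k_ge2 : 2 <= k).

Lemma wordbits_gt0 : (0 < wordbits p)%N.
Proof.
rewrite -(ltr_nat R) (lt_le_trans _ wordbits_ge) // mulr_gt0 //.
exact: lt_le_trans ltr01 (log2_ge1 _ N_ge2).
Qed.

(** A fingerprint has about [log 2 uhi + k * log 2 N] bits; the 3 covers the rounding of [up_log]
    and the character, of at most [2 * log 2 N] bits. The quotient by [wlo] turns bits into words,
    and the final 2 is for the value and the padding. *)
Definition entry_const := (`|log 2 uhi| + k + 3) / wlo + 2.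

Lemma entry_words_le : (entry_words p)%:R <= entry_const.
Proof.
have w0 := wordbits_gt0; have l1 := log2_ge1 R N_ge2.
set w : R := (wordbits p)%:R; have w0R : 0 < w by rewrite ltr0n.
have U0 : (0 < universe p)%N by rewrite expn_gt0 ltnW // (growth_ge2 stg).
have N0 : 0 < N%:R :> R by rewrite ltr0n ltnW // N_ge2.
have ln2 : 0 < ln 2%:R :> R by apply: ln_nat_gt0.
have logU : log 2 (universe p)%:R <= log 2 uhi + k * log 2 N%:R.
  case/andP: (universe_Theta stg) => _ Uhi.
  rewrite /log mulrA -mulrDl ler_wpM2r ?invr_ge0 ?(ltW ln2) // -ln_powR.
  by rewrite -lnM ?posrE ?powR_gt0 // le_ln ?ltr0n.
have cb : (charbits p)%:R <= 2 * log 2 N%:R :> R.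
  apply: le_trans charbits_le _; rewrite ler_wpM2l // /log ler_wpM2r ?invr_ge0 ?(ltW ln2) //.
  by rewrite le_ln ?ltr0n 1?ltnW ?(growth_ge2 stg) // ler_nat (growth_leN stg).
rewrite -(ler_pM2r w0R).
have ewN : (entry_words p * wordbits p <= up_log 2 (universe p) + charbits p + 2 * wordbits p)%N.
  by apply: leq_trans (leq_divM _ _) _; lia.
have ew : (entry_words p)%:R * w <= (up_log 2 (universe p))%:R + (charbits p)%:R + 2 * w :> R.
  by rewrite -!natrM -!natrD ler_nat.
have ul := up_log_le_log R (isT : (1 < 2)%N) U0.
have wl := wordbits_ge; rewrite -/w in wl.
have absu := ler_norm (log 2 uhi).
have e1 : entry_const * w = (`|log 2 uhi| + k + 3) * (w / wlo) + 2 * w.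
  by rewrite /entry_const; ring.
have wl' : log 2 N%:R <= w / wlo by rewrite ler_pdivlMr // mulrC.
have e2 : (`|log 2 uhi| + k + 3) * log 2 N%:R <= (`|log 2 uhi| + k + 3) * (w / wlo).
  by rewrite ler_wpM2l ?addr_ge0 ?normr_ge0 ?(le_trans _ k_ge2).
have e3 : `|log 2 uhi| <= `|log 2 uhi| * log 2 N%:R by rewrite ler_peMr.
rewrite e1; lra.
Qed.

Lemma entry_const_ge0 : 0 <= entry_const.
Proof. exact: le_trans entry_words_le. Qed.

(** Entries take O(1) words, so M/B, which is below [fan_in p + entry_words p + 2], is at most a
    constant power of the fan-in; changing the base costs a constant factor. *)
Lemma log_fan_in : log (fan_in p)%:R N%:R <=
  (entry_const + 4) * log ((memory p)%:R / (block p)%:R) N%:R.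
Proof.
have f2 := fan_in_ge2; have B0 := block_gt0 stg.
have B0R : 0 < (block p)%:R :> R by rewrite ltr0n.
set q : R := _ / _.
have q1 : 1 < q.
  rewrite ltr_pdivlMr // mul1r ltr_nat; apply: leq_trans (memory_ge stg); nia.
have lf : 0 < ln (fan_in p)%:R :> R by exact: ln_nat_gt0.
have lq : 0 < ln q by rewrite ln_gt0.
rewrite /log mulrCA; apply: ler_wpM2l; first exact: ln_nat_ge0.
rewrite ler_pdivlMr // ler_pdivrMl //.
have fe : (fan_in p + entry_words p + 2 <= fan_in p ^ (entry_words p + 4))%N.
  have := ltn_expl (entry_words p) f2; rewrite addn4 !expnS.
  move: (fan_in p ^ entry_words p)%N => P ltP; move: (fan_in p) f2 => f f2. 
  have h1 : (4 * P <= f * (f * P))%N by rewrite mulnA; exact: leq_mul (leq_mul f2 f2) (leqnn P).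
  have h2 : (f <= f * (f * P))%N by rewrite leq_pmulr // muln_gt0 (ltnW f2) andTb (leq_trans _ ltP).
  have : (f * (f * (4 * P)) <= f * (f * (f * (f * P))))%N by rewrite !leq_mul2l h1 !orbT.
  lia.
have qle : q <= ((fan_in p) ^ (entry_words p + 4))%:R.
  rewrite ler_pdivrMr // -natrM ler_nat.
  apply: leq_trans (leq_mul fe (leqnn _)).
  have := ltn_ceil (memory p) B0; have := fan_in_ge2; rewrite /fan_in; nia.
apply: le_trans (le_ln _ qle) _; first exact: lt_trans q1.
rewrite natrX lnXn ?ltr0n 1?ltnW // -[ln _ *+ _]mulr_natl natrD mulrC ler_wpM2l ?(ltW lf) //.
by rewrite lerD2r entry_words_le.
Qed.

End SettingFacts.

(** * Amortized cost of an insertion *)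

Section InsertionCost.
Variables (R : realType) (wlo whi ulo uhi k : R).
Hypotheses (wlo_gt0 : 0 < wlo) (uhi_gt0 : 0 < uhi) (k_ge2 : 2 <= k).

(** The sum of the coefficients obtained for the three terms: [34 * E + 12] for the base-lambda
    logarithm, [15 * E * (E + 4)] for the base-M/B logarithm, and [24 / wlo] for lambda. *)
Definition insertion_const : R :=
  let E := entry_const wlo uhi k in 34 * E + 12 + 15 * E * (E + 4) + 24 / wlo.

Lemma insertion_cost (N : nat) (p : boa_params) (T V : Type)
    (hash : T -> 'I_(universe p)) (s : seq (T * V)) :
  setting wlo whi ulo uhi k N p ->
  (forall l, (0 < l)%N -> routing_ratio R p l = (growth p)%:R) ->
  size s = N ->
  (insertion_ios hash s)%:R / N%:R <=
    insertion_const * (((growth p)%:R + log ((memory p)%:R / (block p)%:R) N%:R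
             + log (growth p)%:R N%:R) / (block p)%:R).
Proof.
move=> stg ratio szs.
have B0 := block_gt0 stg; have g2 := growth_ge2 stg; have w0 := wordbits_gt0 stg wlo_gt0.
have N2 := N_ge2 stg; have f2 := fan_in_ge2 stg.
have := insertion_ios_le g2 B0 w0 (fun l => growth_power stg ratio) hash s (ltnW f2).
rewrite szs /level_bound; move: (insertion_ios hash s) => c.
have lfm := log_fan_in stg wlo_gt0 uhi_gt0 k_ge2.
have Ele := entry_words_le stg wlo_gt0 uhi_gt0 k_ge2.
have E0 := entry_const_ge0 stg wlo_gt0 uhi_gt0 k_ge2.
have tl := trunc_log_le_log R g2 (ltnW N2).
have ul := up_log_le_log R f2 (ltnW g2).
have cbl := charbits_le stg.
have wl := wordbits_ge stg.
have N0R : 0 < N%:R :> R by rewrite ltr0n ltnW.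
have B0R : 0 < (block p)%:R :> R by rewrite ltr0n.
have w0R : 0 < (wordbits p)%:R :> R by rewrite ltr0n.
have lg0 : 0 < ln (growth p)%:R :> R by exact: ln_nat_gt0.
have t1 : 1 <= log (growth p)%:R N%:R :> R.
  by rewrite ler_pdivlMr // mul1r le_ln ?ltr0n 1?ltnW // ler_nat (growth_leN stg).
(* Change of base: levels times passes per level give the logarithm to the base [fan_in p].
   Likewise, in [tcb], levels times bits per character give the bits of a word, which the filters
   are divided by. *)
have tf : log (growth p)%:R N%:R * log (fan_in p)%:R (growth p)%:R
          = log (fan_in p)%:R N%:R :> R.
  by rewrite /log mulrA divfK ?gt_eqF.
have tcb : log (growth p)%:R N%:R * log 2 (growth p)%:R = log 2 N%:R :> R.
  by rewrite /log mulrA divfK ?gt_eqF.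
have lm0 : 0 <= log ((memory p)%:R / (block p)%:R) N%:R :> R.
  apply: log_ge0; last by rewrite ler1n ltnW.
  rewrite ler_pdivlMr // mul1r ler_nat; apply: leq_trans (memory_ge stg).
  by rewrite leq_pmull // addn3.
set t := log (growth p)%:R N%:R in t1 tl tf tcb *.
set lm := log (_ / _) N%:R in lfm lm0 *.
rewrite /insertion_const; move: (entry_const _ _ _) E0 Ele lfm => E E0 Ele lfm.
have tl3 : (trunc_log (growth p) N).+2%:R <= 3 * t by rewrite -!natr1; lra.
rewrite -(ler_nat R) !(natrM, natrD).
have {tf} tu : t * (up_log (fan_in p) (growth p))%:R <= (E + 4) * lm + t.
  apply: le_trans (_ : t * (log (fan_in p)%:R (growth p)%:R + 1) <= _).
    by rewrite ler_wpM2l // (le_trans ler01).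
  by rewrite mulrDr mulr1 tf lerD2r.
have {tcb} tcb : t * (charbits p)%:R <= 2 * ((wordbits p)%:R / wlo).
  apply: le_trans (_ : t * (2 * log 2 (growth p)%:R) <= _).
    by rewrite ler_wpM2l // (le_trans ler01).
  by rewrite mulrCA tcb ler_wpM2l // ler_pdivlMr // mulrC.
have g0 : 0 <= (growth p)%:R :> R by [].
have u0 : 0 <= (up_log (fan_in p) (growth p))%:R :> R by [].
have cb0 : 0 <= (charbits p)%:R :> R by [].
have e0 : 0 <= (entry_words p)%:R :> R by [].
clear lfm ul cbl wl tl.
move: (entry_words p)%:R e0 Ele => e e0 Ele.
move: (up_log _ _)%:R u0 tu => u u0 tu.
move: (charbits p)%:R cb0 tcb => cb cb0 tcb.
clearbody t lm.
move: (wordbits p)%:R w0R tcb => w w0R tcb.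
move: (growth p)%:R g0 => g g0.
move: (block p)%:R B0R => B B0R.
move: (trunc_log _ _).+2%:R tl3 => D D3.
move: N%:R N0R c%:R => n n0 x.
move=> hx.
have t0 : 0 <= t by lra.
have iw : 0 <= wlo^-1 by rewrite invr_ge0 ltW.
have step1 : w * (6 * e + 5 * e * u + 4) + 4 * g * cb <= w * (6 * E + 5 * E * u + 4) + 4 * g * cb.
  rewrite lerD2r ler_wpM2l ?(ltW w0R) // lerD2r.
  by apply: lerD; [rewrite ler_wpM2l | rewrite ler_wpM2r // ler_wpM2l].
have lhs0 : 0 <= w * (6 * e + 5 * e * u + 4) + 4 * g * cb.
  by rewrite !addr_ge0 ?mulr_ge0 ?addr_ge0 ?mulr_ge0 ?(ltW w0R).
have step2 : D * (w * (6 * e + 5 * e * u + 4) + 4 * g * cb)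
   <= 3 * t * (w * (6 * E + 5 * E * u + 4) + 4 * g * cb).
  apply: le_trans (_ : 3 * t * (w * (6 * e + 5 * e * u + 4) + 4 * g * cb) <= _).
    exact: ler_wpM2r.
  by apply: ler_wpM2l => //; apply: mulr_ge0.
have step3 : 15 * (w * E) * (t * u) <= 15 * (w * E) * ((E + 4) * lm + t).
  by apply: ler_wpM2l => //; rewrite !mulr_ge0 // ltW.
have step4 : 12 * g * (t * cb) <= 12 * g * (2 * (w / wlo)).
  by apply: ler_wpM2l => //; apply: mulr_ge0.
have step5 : e * w <= E * t * w.
  by rewrite ler_wpM2r ?(ltW w0R) // (le_trans Ele) // ler_peMr.
have step6 : e * w + D * (w * (6 * e + 5 * e * u + 4) + 4 * g * cb)
    <= w * ((34 * E + 12 + 15 * E * (E + 4) + 24 / wlo) * (g + lm + t)).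
  (* The cross terms left over when each coefficient is replaced by the sum of all three. *)
  have Q0 : 0 <= w * ((34 * E + 12 + 15 * E * (E + 4)) * g + (34 * E + 12 + 24 / wlo) * lm
                      + (15 * E * (E + 4) + 24 / wlo) * t).
    by rewrite mulr_ge0 ?(ltW w0R) // !addr_ge0 // ?mulr_ge0 ?addr_ge0 ?mulr_ge0 ?addr_ge0.
  lra.
rewrite ler_pdivrMr // mulrA mulrAC ler_pdivlMr // -(ler_pM2r w0R).
apply: le_trans (_ : n * (e * w + D * (w * (6 * e + 5 * e * u + 4) + 4 * g * cb)) <= _).
  by apply: le_trans hx; rewrite mulrAC.
have := ler_wpM2l (ltW n0) step6; lra.
Qed.
End InsertionCost.

(** * Moments of the weight of the visited runs *)

Section Moments.
Variables (R : realType) (Seed Key : finType) (mu : Seed -> R).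
Hypothesis mu_ge0 : forall w, 0 <= mu w.
Variables (x : Key) (match_at : nat -> Key -> Seed -> bool) (rate : nat -> R) (kappa : nat).
Implicit Types (c : seq (Key * nat)).

(** A constraint [(y, h)] stands for the event that [y] agrees with [x] on the first [h] characters,
    of probability at most [rate h]. *)
Definition holds c w := all (fun yh => match_at yh.2 yh.1 w) c.
Definition rate_prod c := \prod_(yh <- c) rate yh.2.

Hypothesis rate_ge0 : forall h, 0 <= rate h.
Hypothesis matchP : forall c, uniq (x :: unzip1 c) -> (size c < kappa)%N ->
  Pr mu (holds c) <= rate_prod c.

Variables (I : finType) (elt : I -> {set Key}) (hv hl : I -> nat) (B A : R).
Hypothesis disjoint : forall i j y, y \in elt i -> y \in elt j -> i = j.
Hypothesis B_ge1 : 1 <= B.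
Hypothesis load_mean : forall i, #|elt i|%:R * rate (hl i) <= B.
Hypothesis visit_mean : \sum_i #|elt i|%:R * rate (hv i) <= A.

(** [hv] is the prefix length that routes a query to the run, [hl] the one that determines its
    buckets. *)
Definition visited i w := [exists y in elt i, match_at (hv i) y w].

Definition run_term i w : R :=
  (visited i w)%:R * (B + #|[set y in elt i | match_at (hl i) y w]|%:R).

Definition visited_load w : R :=
  \sum_i run_term i w.

Lemma visited_load_ge0 w : 0 <= visited_load w.
Proof.
by apply: sumr_ge0 => i _; rewrite mulr_ge0 // addr_ge0 // (le_trans ler01).
Qed.

(** In use, [f] is the indicator of the constraints imposed by the factors already expanded. *)
Definition moment m (f : Seed -> R) := \sum_w mu w * f w * visited_load w ^+ m.

Lemma le_moment m f g : (forall w, f w <= g w) -> moment m f <= moment m g.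
Proof.
move=> fg; apply: ler_sum => w _.
by rewrite ler_wpM2r ?exprn_ge0 ?visited_load_ge0 // ler_wpM2l.
Qed.

Lemma momentD m f g : moment m (fun w => f w + g w) = moment m f + moment m g.
Proof. by rewrite -big_split; apply: eq_bigr => w _ /=; rewrite mulrDr mulrDl. Qed.

Lemma momentZ m a f : moment m (fun w => a * f w) = a * moment m f.
Proof. by rewrite /moment big_distrr; apply: eq_bigr => w _ /=; ring. Qed.

Lemma moment_sum m (J : finType) (P : pred J) (f : J -> Seed -> R) :
  moment m (fun w => \sum_(j | P j) f j w) = \sum_(j | P j) moment m (f j).
Proof.
rewrite /moment exchange_big; apply: eq_bigr => w _ /=.
by rewrite big_distrr big_distrl.
Qed.

Lemma momentS m f : moment m.+1 f = moment m (fun w => f w * visited_load w).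
Proof. by apply: eq_bigr => w _; rewrite exprS mulrA; ring. Qed.

Lemma visit_bound_ge0 : 0 <= A.
Proof. by apply: le_trans visit_mean; apply: sumr_ge0 => i _; rewrite mulr_ge0. Qed.

(** A bound per remaining factor: [2 * B] for each run of [Rs], one for each known key, [3 * B * A]
    for all new runs. The coefficient 4 of [m] absorbs the two constraints and the one run that a
    factor may add, as [2 * 1 + 2 = 4]. *)
Definition moment_base c (Rs : {set I}) m : R :=
  B * (2 * #|Rs|%:R + (size c)%:R + 1 + 3 * A + 4 * m%:R).

Lemma rate_prod_ge0 c : 0 <= rate_prod c.
Proof. by apply: prodr_ge0. Qed.

Lemma moment_base_ge0 c Rs m : 0 <= moment_base c Rs m.
Proof.
have A0 := visit_bound_ge0; apply: mulr_ge0; first exact: le_trans ler01 B_ge1.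
by rewrite !addr_ge0 ?mulr_ge0.
Qed.

Lemma card_disjoint (S : seq Key) : \sum_i #|elt i :&: [set y in S]|%:R <= (size S)%:R :> R.
Proof.
rewrite -natr_sum ler_nat.
apply: (@leq_trans #|[set y in S]|); last by rewrite cardsE card_size.
have cardI i : #|elt i :&: [set y in S]| = (\sum_(y in [set y in S]) (y \in elt i))%N.
  rewrite -sum1_card big_mkcond [RHS]big_mkcond; apply: eq_bigr => y _.
  by rewrite !inE; case: (y \in elt i); case: (y \in S).
rewrite (eq_bigr _ (fun i _ => cardI i)) exchange_big -sum1_card /=.
apply: leq_sum => y _; rewrite -big_mkcond sum1_card.
apply/card_le1_eqP => i j yi yj; exact: disjoint yj yi.
Qed.

Lemma card_match i (P : pred Key) :
  #|[set y in elt i | P y]|%:R = \sum_(y in elt i) (P y)%:R :> R.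
Proof.
rewrite -sum1_card natr_sum big_mkcond [RHS]big_mkcond; apply: eq_bigr => y _.
by rewrite !inE; case: (_ \in _); case: (P y).
Qed.

(** It guarantees that the keys of a run outside [Rs] are fresh, so that they can be added to [c]
    without repetition. *)
Definition runs_known c (Rs : {set I}) :=
  forall y i, y \in x :: unzip1 c -> y \in elt i -> i \in Rs.

(** The indicator of the visit is bounded by 1. Known keys count fully towards the load; each other
    key becomes a new constraint, and these sum to at most [B] by [load_mean]. *)
Lemma visited_run_moment m c (Rs : {set I}) i G : 0 <= G ->
  runs_known c Rs -> i \in Rs ->
  moment m (fun w => (holds c w)%:R) <= rate_prod c * G ->
  (forall z, z \in elt i -> z \notin x :: unzip1 c ->
     moment m (fun w => (holds ((z, hl i) :: c) w)%:R) <= rate_prod ((z, hl i) :: c) * G) ->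
  moment m (fun w => (holds c w)%:R * run_term i w)
   <= rate_prod c * G * (2 * B + #|elt i :&: [set y in x :: unzip1 c]|%:R).
Proof.
move=> G0 cl iRs h1 h2; set S := x :: unzip1 c.
apply: le_trans (_ : moment m (fun w => (B + #|elt i :&: [set y in S]|%:R) * (holds c w)%:R
   + \sum_(z | (z \in elt i) && (z \notin S)) (holds ((z, hl i) :: c) w)%:R) <= _).
  apply: le_moment => w; rewrite /run_term card_match /=.
  case: (holds c w); last first.
    rewrite mul0r mulr0 add0r; apply: sumr_ge0 => z _; exact: ler0n.
  rewrite mul1r mulr1 -addrA.
  apply: le_trans (_ : B + \sum_(y in elt i) (match_at (hl i) y w)%:R <= _).
    rewrite ler_piMl ?lern1 ?leq_b1 //.
    by rewrite addr_ge0 ?sumr_ge0 // (le_trans ler01).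
  rewrite lerD2l (bigID (fun z => z \in S)) /=; apply: lerD; last first.
    by apply: ler_sum => z _; rewrite andbT.
  rewrite -sum1_card natr_sum [leRHS](eq_bigl (fun z => (z \in elt i) && (z \in S))).
    by apply: ler_sum => z _; rewrite lern1 leq_b1.
  by move=> z; rewrite !inE.
rewrite momentD momentZ moment_sum.
apply: le_trans (_ : (B + #|elt i :&: [set y in S]|%:R) * (rate_prod c * G) + B * (rate_prod c * G) <= _); last by lra.
apply: lerD; first by apply: ler_wpM2l => //; rewrite addr_ge0 // (le_trans ler01).
apply: le_trans (_ : \sum_(z in elt i) rate (hl i) * (rate_prod c * G) <= _).
  apply: le_trans (_ : \sum_(z | (z \in elt i) && (z \notin S)) rate (hl i) * (rate_prod c * G) <= _).
    apply: ler_sum => z /andP[zi zS]; apply: le_trans (h2 z zi zS) _.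
    by rewrite /rate_prod big_cons /= mulrA.
  rewrite [leRHS](bigID (fun z => z \in S)) /= lerDr sumr_ge0 // => z _.
  by rewrite !mulr_ge0 ?rate_prod_ge0.
rewrite sumr_const -mulr_natl mulrA ler_wpM2r ?mulr_ge0 ?rate_prod_ge0 //.
Qed.

(** Union bound over the key [y] that causes the visit. Given [y], the weight is at most [B + 1],
    with 1 for [y] itself, plus the other matching keys, of mean at most [B]; and
    [2 * B + 1 <= 3 * B]. *)
Lemma new_run_moment m c i G : 0 <= G ->
  (forall y, y \in elt i ->
     moment m (fun w => (holds ((y, hv i) :: c) w)%:R) <= rate_prod ((y, hv i) :: c) * G) ->
  (forall y z, y \in elt i -> z \in elt i -> z != y ->
     moment m (fun w => (holds [:: (z, hl i), (y, hv i) & c] w)%:R)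
       <= rate_prod [:: (z, hl i), (y, hv i) & c] * G) ->
  moment m (fun w => (holds c w)%:R * run_term i w)
   <= rate_prod c * G * (3 * B) * (#|elt i|%:R * rate (hv i)).
Proof.
move=> G0 h1 h2.
apply: le_trans (_ : moment m (fun w => \sum_(y in elt i) ((B + 1) * (holds ((y, hv i) :: c) w)%:R
   + \sum_(z | (z \in elt i) && (z != y)) (holds [:: (z, hl i), (y, hv i) & c] w)%:R)) <= _).
  apply: le_moment => w; rewrite /run_term /= card_match.
  have ge0 y b : 0 <= (B + 1) * (match_at (hv i) y w && b)%:R +
     \sum_(z in elt i | z != y)
        [&& match_at (hl i) z w, match_at (hv i) y w & b]%:R.
    by rewrite addr_ge0 ?sumr_ge0 // mulr_ge0 // addr_ge0 // (le_trans ler01).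
  case: (boolP (holds c w)) => hc; last first.
    by rewrite mul0r; apply: sumr_ge0 => y _; exact: ge0.
  case: (boolP (visited i w)) => [|_]; last first.
    by rewrite mul0r mulr0; apply: sumr_ge0 => y _; exact: ge0.
  case/existsP=> y /andP[yi my]; rewrite [leRHS](bigD1 y) //= !mul1r.
  apply: ler_wpDr; first by apply: sumr_ge0 => z _; exact: ge0.
  rewrite (bigD1 y) //= my mulr1 addrA lerD //.
    by rewrite lerD2l lern1 leq_b1.
  by apply: ler_sum => z _; rewrite !andbT.
rewrite moment_sum.
apply: le_trans (_ : \sum_(y in elt i) rate_prod c * G * (3 * B) * rate (hv i) <= _).
  apply: ler_sum => y yi; rewrite momentD momentZ moment_sum.
  set X := rate (hv i) * (rate_prod c * G); have X0 : 0 <= X by rewrite !mulr_ge0 ?rate_prod_ge0.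
  apply: le_trans (_ : (B + 1) * X + B * X <= _); last first.
    rewrite [leRHS](_ : _ = 3 * B * X); last by rewrite /X; ring.
    have : X <= B * X by rewrite ler_peMl.
    lra.
  apply: lerD.
    apply: ler_wpM2l; first by rewrite addr_ge0 // (le_trans ler01).
    by rewrite (le_trans (h1 y yi)) // /rate_prod big_cons /= -mulrA.
  apply: le_trans (_ : \sum_(z in elt i) rate (hl i) * X <= _).
    apply: le_trans (_ : \sum_(z in elt i | z != y) rate (hl i) * X <= _).
      apply: ler_sum => z /andP[zi zy]; apply: le_trans (h2 y z yi zi zy) _.
      by rewrite /rate_prod !big_cons /= /X !mulrA.
    rewrite [leRHS](bigID (fun z => z != y)) /= lerDl sumr_ge0 // => z _.
    by rewrite mulr_ge0.
  by rewrite sumr_const -mulr_natl mulrA ler_wpM2r.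
rewrite sumr_const -mulr_natl; lra.
Qed.

(* The constraints c have been imposed by the factors expanded so far, which have
   visited the runs Rs. *)
Lemma moment_le m c (Rs : {set I}) :
  uniq (x :: unzip1 c) -> (size c + 2 * m < kappa)%N -> runs_known c Rs ->
  moment m (fun w => (holds c w)%:R) <= rate_prod c * moment_base c Rs m ^+ m.
Proof.
elim: m c Rs => [|m IH] c Rs uc sc cl.
  rewrite expr0 mulr1; apply: le_trans (matchP uc _); last by lia.
  rewrite /Pr [leRHS]big_mkcond /=; apply: ler_sum => w _.
  by rewrite expr0 mulr1; case: (holds c w); rewrite ?mulr1 ?mulr0.
rewrite momentS /visited_load.
rewrite (_ : moment m _ = \sum_i moment m (fun w => (holds c w)%:R *
   run_term i w)); last first.
  rewrite -moment_sum; apply: eq_bigr => w _; congr (_ * _ * _).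
  by rewrite big_distrr.
set b := moment_base c Rs m.+1; have b0 : 0 <= b by apply: moment_base_ge0.
have G0 : 0 <= b ^+ m by apply: exprn_ge0.
have step c' (Rs' : {set I}) : uniq (x :: unzip1 c') -> runs_known c' Rs' ->
    (size c' <= size c + 2)%N -> (#|Rs'| <= #|Rs|.+1)%N ->
    moment m (fun w => (holds c' w)%:R) <= rate_prod c' * b ^+ m.
  move=> uc' cl' sc' sR'; apply: le_trans (IH c' Rs' uc' _ cl') _; first by lia.
  apply: ler_wpM2l; first exact: rate_prod_ge0.
  apply: lerXn2r; rewrite ?nnegrE ?moment_base_ge0 //.
  apply: ler_wpM2l; first exact: le_trans ler01 B_ge1.
  have : (size c')%:R <= (size c)%:R + 2 :> R by rewrite -natrD ler_nat.
  have : #|Rs'|%:R <= #|Rs|%:R + 1 :> R by rewrite natr1 ler_nat.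
  have : m.+1%:R = m%:R + 1 :> R by rewrite natr1.
  lra.
(* The last factor of the power, split over the runs; disjointness of the runs makes the middle
   terms sum to at most the number of known keys. *)
apply: le_trans (_ : \sum_i rate_prod c * b ^+ m * ((i \in Rs)%:R * (2 * B)
     + #|elt i :&: [set y in x :: unzip1 c]|%:R + 3 * B * (#|elt i|%:R * rate (hv i))) <= _).
  apply: ler_sum => i _; case: (boolP (i \in Rs)) => iRs.
    apply: le_trans (visited_run_moment G0 cl iRs _ _) _; last 1 first.
    - apply: ler_wpM2l; first by rewrite mulr_ge0 ?rate_prod_ge0.
      by rewrite mul1r lerDl !mulr_ge0 // (le_trans ler01).
    - by apply: step cl _ _ => //; rewrite leq_addr.
    - move=> z zi zS; apply: (step _ Rs); rewrite ?addn2 //.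
        move: zS uc; rewrite /= !inE !negb_or => /andP[zx ->] /andP[-> ->].
        by rewrite eq_sym zx.
      move=> y j; rewrite /= !inE => /or3P[/eqP -> | /eqP -> zj | yc].
      + by apply: cl; rewrite /= inE eqxx.
      + by rewrite -(disjoint zi zj).
      + by apply: cl; rewrite /= inE yc orbT.
  have fresh y : y \in elt i -> y \notin x :: unzip1 c.
    by move=> yi; apply: contra iRs => yS; exact: cl yS yi.
  have grow d : (forall y, y \in unzip1 d -> y \in elt i) -> runs_known (d ++ c) (i |: Rs).
    move=> di y j; rewrite /unzip1 map_cat inE mem_cat.
    case/or3P=> [/eqP -> xj|/di yi yj|yc yj].
    - by rewrite !inE (cl x j) ?orbT //= inE eqxx.
    - by rewrite !inE (disjoint yi yj) eqxx.
    - by rewrite !inE (cl y j) ?orbT //= inE yc orbT.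
  apply: le_trans (new_run_moment G0 _ _) _; last 1 first.
  - rewrite mul0r add0r -[leLHS]mulrA; apply: ler_wpM2l; first by rewrite mulr_ge0 ?rate_prod_ge0.
    by rewrite lerDr.
  - move=> y yi; apply: (step _ (i |: Rs)).
    + by move: (fresh y yi) uc; rewrite /= !inE !negb_or eq_sym => /andP[-> ->] /andP[-> ->].
    + by apply: (grow [:: (y, hv i)]) => z; rewrite inE => /eqP ->.
    + by rewrite addn2.
    + by rewrite cardsU1; case: (_ \notin _).
  - move=> y z yi zi zy; apply: (step _ (i |: Rs)).
    + move: (fresh y yi) (fresh z zi) uc; rewrite /= !inE !negb_or zy.
      by rewrite !(eq_sym x) => /andP[-> ->] /andP[-> ->] /andP[-> ->].
    + apply: (grow [:: (z, hl i); (y, hv i)]) => u.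
      by rewrite !inE => /orP[] /eqP ->.
    + by rewrite addn2.
    + by rewrite cardsU1; case: (_ \notin _).
rewrite -big_distrr /= !big_split /= exprSr mulrA.
apply: ler_wpM2l; first by rewrite mulr_ge0 ?rate_prod_ge0.
rewrite -big_distrl -big_distrr -natr_sum /=.
have -> : (\sum_i (i \in Rs) = #|Rs|)%N by rewrite -sum1_card [RHS]big_mkcond.
have disj := card_disjoint (x :: unzip1 c); rewrite /= size_map -natr1 in disj.
have visit : 3 * B * (\sum_i #|elt i|%:R * rate (hv i)) <= 3 * B * A.
  by rewrite ler_wpM2l // mulr_ge0 // (le_trans ler01).
have c1 : (size c)%:R + 1 <= B * ((size c)%:R + 1) :> R by rewrite ler_peMl // addr_ge0.
have m0 : 0 <= B * (4 * m.+1%:R) by rewrite !mulr_ge0 // (le_trans ler01).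
rewrite /b /moment_base; lra.
Qed.
End Moments.

(** * Limited independence *)

Section Independence.
Variables (R : realType) (Seed Key : finType) (mu : Seed -> R) (u kappa : nat).
Variable H : Seed -> Key -> 'I_u.
Hypothesis indep : kwise_independent mu kappa H.

Lemma eq_Pr (E E' : pred Seed) : E =1 E' -> Pr mu E = Pr mu E'.
Proof. exact: eq_bigl. Qed.

Lemma Pr_split (U : finType) (g : Seed -> U) (A : pred U) (E : pred Seed) :
  Pr mu (fun w => (g w \in A) && E w) = \sum_(a in A) Pr mu (fun w => (g w == a) && E w).
Proof.
rewrite /Pr (exchange_big_dep (fun w => (g w \in A) && E w)) /=; last first.
  by move=> a w aA /andP[/eqP -> ->]; rewrite aA.
apply: eq_bigr => w /andP[gA Ew].
rewrite (big_pred1 (g w)) // => a /=; rewrite Ew andbT eq_sym.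
by case: eqP => [->|_]; rewrite ?andbF // andbT.
Qed.

(** Independence is given for point values. The induction splits the event of the first key of [c]
    into points and moves this key to [xs], updating [v] there. *)
Lemma kwise_events (c : seq (Key * {set 'I_u})) (xs : seq Key) (v : Key -> 'I_u) :
  uniq (unzip1 c ++ xs) -> (size c + size xs <= kappa)%N ->
  Pr mu (fun w => all (fun yA : Key * {set 'I_u} => H w yA.1 \in yA.2) c
                  && all (fun x => H w x == v x) xs)
  = (\prod_(yA <- c) (#|yA.2|%:R / u%:R)) * u%:R^-1 ^+ size xs.
Proof.
elim: c xs v => [|[y A] c IH] xs v /= un sz.
  by rewrite big_nil mul1r; exact: indep.
have [yc yxs] : y \notin unzip1 c /\ y \notin xs.
  by move: un; rewrite mem_cat negb_or => /andP[/andP[]].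
rewrite (eq_Pr (E' := fun w => (H w y \in A) &&
  (all (fun yA : Key * {set 'I_u} => H w yA.1 \in yA.2) c
   && all (fun x => H w x == v x) xs))); last first.
  by move=> w; rewrite /= andbA.
rewrite Pr_split.
transitivity (\sum_(a in A) (\prod_(yA <- c) (#|yA.2|%:R / u%:R)) * (u%:R^-1 : R) ^+ (size xs).+1).
  apply: eq_bigr => a aA.
  rewrite -(IH (y :: xs) (fun z => if z == y then a else v z)); last 2 first.
  - by rewrite uniq_catC /= mem_cat uniq_catC negb_or yc yxs; case/andP: un.
  - by rewrite /= addnS.
  apply: eq_Pr => w /=; rewrite eqxx andbCA; congr (_ && (_ && _)).
  apply: eq_in_all => z zxs; case: (z =P y) => // zy.
  by rewrite -zy zxs in yxs.
rewrite sumr_const big_cons exprS /=.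
by rewrite -mulr_natl; ring.
Qed.

End Independence.

(** * Probability that given keys match the prefixes of the queried key *)

Section PrefixMatch.
Variables (R : realType) (p : boa_params) (Seed Key : finType) (mu : Seed -> R) (kappa : nat).
Variable hash : Seed -> Key -> 'I_(universe p).
Hypothesis growth_gt0 : (0 < growth p)%N.
Hypothesis indep : kwise_independent mu kappa hash.

(* This is growth^-h when h <= fplen, and 1 / universe otherwise. *)
Definition match_prob h : R := (growth p ^ (fplen p - h))%:R / (universe p)%:R.

Definition match_at (x : Key) h y w := matches p h (hash w x) (hash w y).

(** Fingerprints with the same quotient by [d] are told apart by their remainder. *)
Lemma card_prefix h (q : nat) :
  (#|[set K : 'I_(universe p) | Defs.prefix p h K == q]| <= growth p ^ (fplen p - h))%N.
Proof.
set d := (growth p ^ _)%N; have d0 : (0 < d)%N by rewrite expn_gt0 growth_gt0.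
pose g (K : 'I_(universe p)) : 'I_d := Ordinal (ltn_pmod K d0).
rewrite -(card_in_imset (f := g)); first by rewrite -[leqRHS]card_ord max_card.
move=> K K'; rewrite !inE => /eqP qK /eqP qK' /(congr1 val) /= eqm.
by apply: val_inj; rewrite /= (divn_eq K d) (divn_eq K' d) eqm -/(Defs.prefix p h K)
  -/(Defs.prefix p h K') qK qK'.
Qed.

(** Once the hash of [x] is fixed to [v], the matches are independent events about the other keys.
    Fixing it uses one unit of independence, whence the strict inequality. *)
Lemma matchP x c : uniq (x :: unzip1 c) -> (size c < kappa)%N ->
  Pr mu (holds (match_at x) c) <= rate_prod match_prob c.
Proof.
move=> uc sc; set U := universe p.
pose ev v := [seq (yh.1, [set K : 'I_U | matches p yh.2 v K]) | yh <- c].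
rewrite (eq_Pr mu (E' := fun w => (hash w x \in predT) && holds (match_at x) c w)) //.
rewrite Pr_split.
apply: le_trans (_ : \sum_(v : 'I_U) rate_prod match_prob c * U%:R^-1 <= _).
  apply: ler_sum => v _.
  rewrite (eq_Pr mu (E' := fun w => all (fun yA : Key * {set 'I_U} => hash w yA.1 \in yA.2) (ev v)
     && all (fun x => hash w x == v) [:: x])); last first.
    move=> w; rewrite /= andbT andbC; case: eqP => [xv|]; rewrite ?andbF // !andbT.
    by rewrite /holds /ev all_map; apply: eq_all => yh; rewrite /= inE /match_at xv.
  rewrite (kwise_events indep); last 2 first.
  - by rewrite cats1 rcons_uniq /ev /unzip1 -map_comp; exact: uc.
  - by rewrite size_map addn1.
  rewrite expr1 ler_wpM2r ?invr_ge0 // /rate_prod big_map.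
  elim: c {uc sc ev} => [|[y h] c IH]; first by rewrite !big_nil.
  rewrite !big_cons; apply: ler_pM => //=.
  - by rewrite divr_ge0.
  - by apply: prodr_ge0 => yh _; rewrite divr_ge0.
  by rewrite ler_wpM2r ?invr_ge0 // ler_nat; exact: card_prefix.
rewrite sumr_const card_ord -[leLHS]mulr_natl mulrCA divff ?mulr1 // pnatr_eq0 -lt0n.
by rewrite expn_gt0 growth_gt0.
Qed.

End PrefixMatch.

Lemma Pr_markov (R : realType) (Seed : finType) (mu : Seed -> R) (Y : Seed -> R) a m :
  (forall w, 0 <= mu w) -> (forall w, 0 <= Y w) -> 0 < a ->
  Pr mu (fun w => a < Y w) <= (\sum_w mu w * Y w ^+ m) / a ^+ m.
Proof.
move=> mu0 Y0 a0; rewrite ler_pdivlMr ?exprn_gt0 // /Pr big_distrl /=.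
rewrite big_mkcond; apply: ler_sum => w _; case: ifP => [aY|_].
  by apply: ler_wpM2l => //; apply: lerXn2r; rewrite ?nnegrE // ltW.
by rewrite mulr_ge0 ?exprn_ge0.
Qed.

(** * The query bound *)

Section QueryTail.
Variables (R : realType) (p : boa_params) (Seed Key : finType) (V : Type).
Variables (mu : Seed -> R) (kappa : nat) (hash : Seed -> Key -> 'I_(universe p)).
Variables (s : seq (Key * V)) (x : Key) (N : nat) (Cu : R).
Hypotheses (growth_gt1 : (1 < growth p)%N) (B_gt0 : (0 < block p)%N)
  (w_gt0 : (0 < wordbits p)%N) (fan_in_gt0 : (0 < fan_in p)%N).
Hypothesis ratio : forall l, (0 < l)%N -> (growth p ^ hlen p l = block p * growth p ^ l)%N.
Hypothesis mu_ge0 : forall w, 0 <= mu w.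
Hypothesis indep : kwise_independent mu kappa hash.
Hypotheses (uniq_keys : uniq (unzip1 s)) (size_s : (size s <= N)%N).
Hypotheses (growth_leN : (growth p <= N)%N) (N_leU : (N <= universe p)%N).
Hypotheses (Cu_ge1 : 1 <= Cu) (N2_leU : (N ^ 2)%:R <= Cu * (universe p)%:R).

Let klvs := (key_insert_all p (unzip1 s)).2.
Let rl := runs_from 0 klvs.
Let elt (i : 'I_(size rl)) := [set y in (nth (0%N, [::]) rl i).2].
Let lev (i : 'I_(size rl)) := (nth (0%N, [::]) rl i).1.
Let D := (trunc_log (growth p) N).+1.
Let Y : Seed -> R :=
  visited_load (match_at hash x) elt (fun i => hlen p (lev i).+1) lev (block p)%:R.

Let uniq_runs : uniq (flatten (unzip2 rl)).
Proof.
rewrite flatten_runs_from; have := perm_uniq (perm_key_insert_all p (unzip1 s)).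
by rewrite uniq_keys cat_uniq => /and3P[].
Qed.

Let nth_run i : (nth (0%N, [::]) rl i).2 = nth [::] (unzip2 rl) i.
Proof.
case: (ltnP i (size rl)) => i_rl; first by rewrite (nth_map (0%N, [::])).
by rewrite !nth_default ?size_map.
Qed.

Let uniq_run i : uniq (nth (0%N, [::]) rl i).2.
Proof.
rewrite nth_run; elim: (unzip2 rl) i uniq_runs => [|r ss IH] [|i] //=.
  by rewrite cat_uniq => /and3P[].
by rewrite cat_uniq => /and3P[_ _]; exact: IH.
Qed.

Let levelP i : ((lev i <= fplen p) && (growth p ^ lev i * block p <= N)
   && (#|elt i| <= growth p ^ lev i * block p))%N.
Proof.
have szk : (size (unzip1 s) <= N)%N by rewrite size_map.
have [sD pw] := key_levels_le growth_gt1 B_gt0 szk.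
have [sh _ _] := key_insert_allP growth_gt1 B_gt0 (unzip1 s).
have [/all_nthP al _] := runs_fromP growth_gt1 B_gt0 sh.
have /andP[li /eqP szi] := al (0%N, [::]) i (ltn_ord i).
have wN := pw _ li; rewrite -/(lev i) in wN li.
rewrite wN -szi cardsE card_size !andbT.
rewrite -(leq_exp2l _ _ growth_gt1); apply: leq_trans (leq_trans wN N_leU).
by rewrite leq_pmulr.
Qed.

Let size_rl : (size rl <= growth p * D)%N.
Proof.
have szk : (size (unzip1 s) <= N)%N by rewrite size_map.
have [sD pw] := key_levels_le growth_gt1 B_gt0 szk.
have [sh _ _] := key_insert_allP growth_gt1 B_gt0 (unzip1 s).
have [_ szr] := runs_fromP growth_gt1 B_gt0 sh.
by apply: leq_trans szr _; rewrite leq_mul2l sD orbT.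
Qed.

(** Markov's inequality for the m-th moment, started without constraints. In [moment_base] the 7 is
    2 for the run of [x], 1, and 4 from [m <= D]; the mean number of matching keys is at most
    [Cu * D]. *)
Lemma visited_load_tail m a : (2 * m < kappa)%N -> (m <= D)%N -> 0 < a ->
  Pr mu (fun w => (block p)%:R * a * D%:R < Y w) <= ((7 + 3 * Cu) / a) ^+ m.
Proof.
move=> mk mD a0.
have U0 : 0 < (universe p)%:R :> R by rewrite ltr0n expn_gt0 ltnW.
have B0 : 0 < (block p)%:R :> R by rewrite ltr0n.
have g0 : 0 < (growth p)%:R :> R by rewrite ltr0n ltnW.
have D0 : 0 < D%:R :> R by rewrite ltr0n.
have Cu0 : 0 < Cu by apply: lt_le_trans Cu_ge1.
have dis i j y : y \in elt i -> y \in elt j -> i = j.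
  rewrite !inE !nth_run => yi yj; apply: val_inj; exact: uniq_flatten_inj uniq_runs yi yj.
have B1 : 1 <= (block p)%:R :> R by rewrite ler1n.
have load i : #|elt i|%:R * match_prob R p (lev i) <= (block p)%:R.
  have /andP[/andP[eL _] card] := levelP i.
  rewrite /match_prob mulrA ler_pdivrMr // -!natrM ler_nat.
  apply: leq_trans (leq_mul card (leqnn _)) _.
  by rewrite mulnAC -expnD subnKC // mulnC.
(* There are at most [growth p * D] runs, and the routing ratio makes each expect at most
   [Cu / growth p] matches. The factor [Cu] serves when the prefix is longer than a fingerprint: a
   match then has probability [1 / universe], and [growth p ^ h <= N ^ 2]. *)
have visit : \sum_i #|elt i|%:R * match_prob R p (hlen p (lev i).+1) <= Cu * D%:R.
  apply: le_trans (_ : \sum_(i < size rl) Cu / (growth p)%:R <= _); last first.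
    rewrite sumr_const card_ord -[leLHS]mulr_natl mulrCA ler_wpM2l ?(ltW Cu0) //.
    by rewrite ler_pdivrMr // -natrM ler_nat mulnC.
  apply: ler_sum => i _; have /andP[/andP[eL eN] card] := levelP i.
  rewrite /match_prob mulrA ler_pdivrMr // mulrAC ler_pdivlMr // -!natrM.
  set h := hlen p _.
  have gh : (#|elt i| * growth p <= growth p ^ h)%N.
    rewrite ratio // expnS mulnCA mulnC leq_mul2l mulnC.
    by rewrite (leq_trans card) ?orbT // mulnC.
  have hN : (growth p ^ h <= N ^ 2)%N.
    by rewrite ratio // expnS mulnCA -mulnn leq_mul // mulnC.
  apply: le_trans (_ : (growth p ^ h * growth p ^ (fplen p - h))%:R <= _).
    by rewrite ler_nat mulnAC leq_mul.
  case: (leqP h (fplen p)) => hL.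
    by rewrite -expnD subnKC // ler_peMl // ltW.
  rewrite (eqP (ltnW hL : (fplen p - h == 0)%N)) muln1.
  by apply: le_trans N2_leU; rewrite ler_nat.
have mp0 h : 0 <= match_prob R p h by rewrite divr_ge0.
have Y0 w : 0 <= Y w by apply: visited_load_ge0.
apply: le_trans (Pr_markov m mu_ge0 Y0 _) _; first by rewrite !mulr_gt0.
have := moment_le mu_ge0 mp0 (fun c => @matchP _ _ _ _ _ _ _ (ltnW growth_gt1) indep x c)
   dis B1 load visit (m := m) (c := [::]) (Rs := [set i | x \in elt i]).
(* The expansion starts from the only run that may contain [x] itself, and whose visit is then
   certain. *)
have card1 : (#|[set i | x \in elt i]| <= 1)%N.
  apply/card_le1_eqP => i j; rewrite in_set => xi; rewrite in_set => xj.
  exact: dis xj xi.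
have cl : runs_known x elt [::] [set i | x \in elt i].
  by move=> y i; rewrite mem_seq1 => /eqP ->; rewrite in_set.
move=> /(_ isT mk cl); rewrite /rate_prod big_nil mul1r => mom.
have {}mom : \sum_w mu w * Y w ^+ m <=
    moment_base (block p)%:R (Cu * D%:R) ([::] : seq (Key * nat)) [set i | x \in elt i] m ^+ m.
  by apply: le_trans _ mom; apply: ler_sum => w _; rewrite mulr1.
rewrite ler_pdivrMr ?exprn_gt0 ?mulr_gt0 //; apply: le_trans mom _.
rewrite -exprMn; apply: lerXn2r.
- by rewrite nnegrE; apply: moment_base_ge0 B1 visit _ _ _.
- by rewrite nnegrE !mulr_ge0 ?addr_ge0 ?mulr_ge0 ?invr_ge0 // ltW.
rewrite (_ : _ / a * _ = (block p)%:R * ((7 + 3 * Cu) * D%:R)); last first.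
  by field; rewrite gt_eqF.
rewrite ler_wpM2l ?(ltW B0) //.
have : #|[set i | x \in elt i]|%:R <= 1 :> R by rewrite lern1.
have : 1 <= D%:R :> R by rewrite ler1n.
have : m%:R <= D%:R :> R by rewrite ler_nat.
rewrite /=; lra.
Qed.

Lemma query_ios_tail m a F : (2 * m < kappa)%N -> (m <= D)%N -> 0 < a ->
  (charbits p <= F * wordbits p)%N ->
  Pr mu (fun w => D%:R * (F%:R + 2) + 3 * (entry_words p)%:R * a * D%:R
                  < (query_ios (hash w) s x)%:R) <= ((7 + 3 * Cu) / a) ^+ m.
Proof.
move=> mk mD a0 cb; apply: le_trans (visited_load_tail mk mD a0).
have B0 : 0 < (block p)%:R :> R by rewrite ltr0n.
have szk : (size (unzip1 s) <= N)%N by rewrite size_map.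
have [sD _] := key_levels_le growth_gt1 B_gt0 szk; rewrite -/klvs -/D in sD.
have sL : (size klvs <= (fplen p).+1)%N.
  apply: leq_trans sD _; rewrite ltnS -(leq_exp2l _ _ growth_gt1).
  by apply: leq_trans N_leU; rewrite trunc_logP // (leq_trans _ growth_leN) // ltnW.
rewrite /Pr big_mkcond [leRHS]big_mkcond; apply: ler_sum => w _.
case: ifP => [lt_q|_]; last by case: ifP.
rewrite ifT // ltNge; apply: contraTN lt_q => le_Y; rewrite -leNgt -(ler_pM2r B0).
have := @query_ios_le p growth_gt1 B_gt0 Key V (hash w) s x F w_gt0 fan_in_gt0 cb sL.
rewrite -/klvs -/rl.
have eqY : (\sum_(er <- rl) run_weight p (fun y => hash w y) (hash w x) er)%:R = Y w.
  rewrite natr_sum (big_nth (0%N, [::])) big_mkord; apply: eq_bigr => i _.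
  rewrite /run_weight natrM natrD; congr (_%:R * (_ + _%:R)).
    congr nat_of_bool; apply/hasP/existsP => [[y yr my]|[y /andP[yr my]]]; exists y => //.
      by rewrite inE yr.
    by rewrite inE in yr.
  rewrite -size_filter -(card_uniqP (filter_uniq _ (uniq_run i))).
  by apply: eq_card => y; rewrite mem_filter !inE andbC.
rewrite -(ler_nat R) natrD !natrM eqY => le_q.
apply: le_trans le_q _.
have sDR : (size klvs)%:R <= D%:R :> R by rewrite ler_nat.
have := ler_wpM2r (mulr_ge0 (addr_ge0 (ler0n R F) (ler0n R 2)) (ltW B0)) sDR.
have : 0 <= 3 * (entry_words p)%:R :> R by rewrite mulr_ge0.
move=> /ler_wpM2l/(_ _ _ le_Y); rewrite natrD; lra.
Qed.
End QueryTail.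

(** * Choice of the constants and of the order of the moment *)

Section QueryCostWhp.
Variables (R : realType) (wlo whi ulo uhi k klo khi : R).
Hypotheses (wlo_gt0 : 0 < wlo) (ulo_gt0 : 0 < ulo) (uhi_gt0 : 0 < uhi) (k_ge2 : 2 <= k)
  (klo_gt0 : 0 < klo).
Variable d : R.

Let bound_gt (y : R) : 0 <= y -> y < (Num.bound y)%:R.
Proof. by move=> y0; rewrite archi_boundP. Qed.

(** The moment has order [D %/ q + 1]: [q] exceeds [8 / klo] to fit the available independence, and
    1 to keep the order at most [D]. *)
Let q := (Num.bound (8 / klo)).+2.
Let Cu := 1 + ulo^-1.
(** With [a] below, the ratio in the tail bound is [2 ^- e], and its m-th power is small enough
    because [q * m >= D]. *)
Let e := (Num.bound `|d| * q)%N.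
Let a := (7 + 3 * Cu) * 2 ^+ e.
Let F := Num.bound (2 / wlo).

Definition query_const : R := 2 * ((F%:R + 2) + 3 * entry_const wlo uhi k * a).
(** The first summand ensures [log 2 N > 4 / klo], the second [ulo * N >= 1], so that the universe
    has at least [N] fingerprints. *)
Definition query_N0 : nat := (2 ^ Num.bound (4 / klo) + Num.bound ulo^-1)%N.

Lemma query_cost_whp (c : R) (N : nat) (p : boa_params) (Key : finType) (V : Type)
    (Seed : finType) (mu : Seed -> R) (hash : Seed -> Key -> 'I_(universe p)) (kappa : nat)
    (s : seq (Key * V)) (x : Key) :
  (query_N0 <= N)%N -> setting wlo whi ulo uhi k N p ->
  (forall l, (0 < l)%N -> routing_ratio R p l = (growth p)%:R) ->
  distribution mu -> between klo khi kappa%:R (log 2 N%:R) ->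
  kwise_independent mu kappa hash ->
  uniq [seq y.1 | y <- s] -> (size s <= N)%N ->
  c * log 2 (growth p)%:R <= d ->
  1 - N%:R `^ (- c) <=
    Pr mu (fun w => (query_ios (hash w) s x)%:R <= query_const * log (growth p)%:R N%:R).
Proof.
move=> N0N stg ratio [mu0 mu1] /andP[kappa_ge _] indep us szs cd.
have g2 := growth_ge2 stg; have N2 := N_ge2 stg; have gN := growth_leN stg.
have N0 : 0 < N%:R :> R by rewrite ltr0n ltnW.
have lg0 : 0 < ln (growth p)%:R :> R by exact: ln_nat_gt0.
have l20 : 0 < ln 2 :> R by exact: (@ln_nat_gt0 R 2).
have lN0 : 0 < ln N%:R :> R by exact: ln_nat_gt0.
have iulo0 : 0 < ulo^-1 by rewrite invr_gt0.
have Cu1 : 1 <= Cu by rewrite /Cu lerDl ltW.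
have NkU : ulo * N%:R ^+ 2 <= (universe p)%:R.
  case/andP: (universe_Theta stg) => Ulo _; apply: le_trans Ulo.
  by rewrite ler_wpM2l ?(ltW ulo_gt0) // -powR_mulrn ?ler0n // ler_powR // ler1n ltnW.
have uloN : 1 <= ulo * N%:R.
  rewrite -ler_pdivrMl // mulr1; apply: ltW; apply: lt_le_trans (bound_gt (ltW iulo0)) _.
  by rewrite ler_nat (leq_trans _ N0N) // leq_addl.
have NU : (N <= universe p)%N.
  rewrite -(ler_nat R); apply: le_trans NkU.
  by rewrite expr2 mulrA ler_peMl // ltW.
have N2U : (N ^ 2)%:R <= Cu * (universe p)%:R.
  rewrite natrX; apply: le_trans (_ : ulo^-1 * (universe p)%:R <= _).
    by rewrite ler_pdivlMl.
  by rewrite ler_wpM2r // /Cu lerDr.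
set D := (trunc_log (growth p) N).+1; set t := log (growth p)%:R N%:R.
have tD : t <= D%:R by exact: log_le_trunc_log (ltnW N2).
have t1 : 1 <= t by rewrite ler_pdivlMr // mul1r le_ln ?ltr0n 1?ltnW // ler_nat.
have Dt : D%:R <= 2 * t.
  by rewrite /D -natr1; have := trunc_log_le_log R g2 (ltnW N2); rewrite -/t; lra.
have tL : t <= log 2 N%:R.
  rewrite /t /log ler_wpM2l ?(ltW lN0) // lef_pV2 ?posrE // le_ln // ler_nat //.
have L2 : 4 / klo < log 2 N%:R.
  apply: lt_le_trans (bound_gt _) _; first by rewrite divr_ge0 // ltW.
  rewrite /log ler_pdivlMr // [leLHS]mulr_natl -lnXn // le_ln ?exprn_gt0 // -natrX ler_nat.
  by apply: leq_trans N0N; rewrite leq_addr.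
set m := (D %/ q).+1.
(* As [D <= 2 * log 2 N], the part [2 * (D %/ q)] is at most half of [klo * log 2 N]; the remaining
   2 is less than the other half by [L2]. *)
have mk : (2 * m < kappa)%N.
  rewrite -(ltr_nat R); apply: lt_le_trans kappa_ge.
  have q0 : 0 < q%:R :> R by rewrite ltr0n.
  have Dq : (D %/ q)%:R * q%:R <= D%:R :> R by rewrite -natrM ler_nat leq_divM.
  have q8 : 8 / klo <= q%:R.
    apply: ltW; apply: lt_le_trans (bound_gt _) _; first by rewrite divr_ge0 // ltW.
    by rewrite ler_nat; exact: leqW (leqnSn _).
  rewrite ler_pdivrMr // in q8; rewrite ltr_pdivrMr // in L2.
  have h1 : (D %/ q)%:R * 8 <= (D %/ q)%:R * (q%:R * klo) by rewrite ler_wpM2l.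
  have h2 : (D %/ q)%:R * q%:R * klo <= D%:R * klo by rewrite ler_wpM2r // ltW.
  have h3 : D%:R * klo <= 2 * log 2 N%:R * klo.
    by rewrite ler_wpM2r ?(ltW klo_gt0) //; lra.
  rewrite natrM /m -natr1; lra.
have mD : (m <= D)%N.
  rewrite /m ltn_Pdiv //.
have a0 : 0 < a by rewrite mulr_gt0 ?exprn_gt0 //; have := Cu1; lra.
have cb : (charbits p <= F * wordbits p)%N.
  rewrite -(ler_nat R) natrM; apply: le_trans (charbits_le stg) _.
  apply: le_trans (_ : 2 * log 2 N%:R <= _).
    rewrite ler_wpM2l // /log ler_wpM2r ?invr_ge0 ?(ltW l20) // le_ln ?ltr0n ?ler_nat //.
    exact: ltnW.
  have wl := wordbits_ge stg.
  apply: le_trans (_ : 2 / wlo * (wordbits p)%:R <= _).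
    by rewrite -mulrA ler_wpM2l // mulrC ler_pdivlMr // mulrC.
  by rewrite ler_wpM2r // ltW // bound_gt // divr_ge0 // ltW.
have fail := query_ios_tail x g2 (block_gt0 stg) (wordbits_gt0 stg wlo_gt0)
  (ltnW (fan_in_ge2 stg)) (fun l => growth_power stg ratio) mu0
  indep us szs gN NU Cu1 N2U mk mD a0 cb.
have -> : Pr mu (fun w => (query_ios (hash w) s x)%:R <= query_const * t)
  = 1 - Pr mu (fun w => query_const * t < (query_ios (hash w) s x)%:R).
  apply: (canRL (addrK _)).
  rewrite -[RHS]mu1 /Pr [RHS](bigID (fun w => (query_ios (hash w) s x)%:R <= query_const * t)) /=.
  by congr (_ + _); apply: eq_bigl => w; rewrite ltNge.
rewrite lerD2l lerN2.
apply: le_trans (_ : Pr mu (fun w => D%:R * (F%:R + 2) + 3 * (entry_words p)%:R * a * D%:R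
                  < (query_ios (hash w) s x)%:R) <= _).
  rewrite /Pr big_mkcond [leRHS]big_mkcond; apply: ler_sum => w _.
  case: ifP => [lt_q|_]; last by case: ifP.
  rewrite ifT //; apply: le_lt_trans lt_q.
  have ewE := entry_words_le stg wlo_gt0 uhi_gt0 k_ge2.
  rewrite /query_const.
  have h1 : 3 * (entry_words p)%:R * a * D%:R <= 3 * entry_const wlo uhi k * a * D%:R.
    by rewrite !ler_wpM2r // ?(ltW a0) // ler_wpM2l.
  have : (F%:R + 2 + 3 * entry_const wlo uhi k * a) * D%:R
       <= (F%:R + 2 + 3 * entry_const wlo uhi k * a) * (2 * t).
    apply: ler_wpM2l => //; apply: addr_ge0; first by rewrite addr_ge0.
    apply: mulr_ge0 (ltW a0); apply: mulr_ge0 => //.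
    exact: entry_const_ge0 stg wlo_gt0 uhi_gt0 k_ge2.
  lra.
apply: (le_trans fail).
have -> : (7 + 3 * Cu) / a = (2 ^+ e)^-1.
  rewrite /a invfM mulrA divff ?mul1r // gt_eqF //; have := Cu1; lra.
rewrite exprVn -exprM -ler_ln ?posrE ?invr_gt0 ?exprn_gt0 ?powR_gt0 //.
rewrite lnV ?posrE ?exprn_gt0 // lnXn // ln_powR mulNr lerN2.
have tln : t * ln (growth p)%:R = ln N%:R by rewrite /t /log divfK // gt_eqF.
have lg2 : log 2 (growth p)%:R * ln 2 = ln (growth p)%:R :> R by rewrite /log divfK // gt_eqF.
(* In base 2, the exponent to reach is [c * log 2 N], that is [c * log 2 (growth p) * t], which is
   at most [d * t]; the exponent obtained is [e * m], at least [Num.bound] of [d] in absolute value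
   times [D]. *)
rewrite -tln -lg2 -[leRHS]mulr_natr.
rewrite [leLHS](_ : _ = ln 2 * (c * log 2 (growth p)%:R * t)); last by ring.
apply: ler_wpM2l; first exact: ltW.
set dn := Num.bound `|d|.
have ddn : d <= dn%:R by apply: ltW; apply: le_lt_trans (ler_norm _) (bound_gt (normr_ge0 _)).
have Dqm : D%:R <= (q * m)%:R :> R by rewrite ler_nat mulnC ltnW // ltn_ceil.
have t0 : 0 <= t by apply: le_trans t1; exact: ler01.
apply: le_trans (_ : dn%:R * t <= _).
  by apply: ler_wpM2r => //; exact: le_trans cd ddn.
rewrite /e -/dn -mulnA natrM; apply: ler_wpM2l => //.
exact: le_trans tD Dqm.
Qed.
End QueryCostWhp.

Theorem theorem2 (R : realType) (wlo whi ulo uhi k klo khi : R)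
    (wlo_gt0 : 0 < wlo) (whi_gt0 : 0 < whi) (ulo_gt0 : 0 < ulo)
    (uhi_gt0 : 0 < uhi) (k_ge2 : 2 <= k) (klo_gt0 : 0 < klo)
    (khi_gt0 : 0 < khi) :
  (exists C : R,
     forall (N : nat) (p : boa_params) (Key : finType) (V : Type)
       (hash : Key -> 'I_(universe p)) (s : seq (Key * V)),
     setting wlo whi ulo uhi k N p ->
     (forall l, (0 < l)%N -> routing_ratio R p l = (growth p)%:R) ->
     size s = N ->
     (insertion_ios hash s)%:R / N%:R <=
       C * (((growth p)%:R + log ((memory p)%:R / (block p)%:R) N%:R
             + log (growth p)%:R N%:R) / (block p)%:R))
  /\
  (forall d : R, exists (C : R) (N0 : nat),
     forall (c : R) (N : nat) (p : boa_params) (Key : finType) (V : Type)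
       (Seed : finType) (mu : Seed -> R)
       (hash : Seed -> Key -> 'I_(universe p)) (kappa : nat)
       (s : seq (Key * V)) (x : Key),
     (N0 <= N)%N ->
     setting wlo whi ulo uhi k N p ->
     (forall l, (0 < l)%N -> routing_ratio R p l = (growth p)%:R) ->
     distribution mu ->
     between klo khi kappa%:R (log 2 N%:R) ->
     kwise_independent mu kappa hash ->
     uniq [seq y.1 | y <- s] ->
     (size s <= N)%N ->
     c * log 2 (growth p)%:R <= d ->
     1 - N%:R `^ (- c) <=
       Pr mu (fun w => (query_ios (hash w) s x)%:R
                         <= C * log (growth p)%:R N%:R)).
Proof.
split.
  exists (insertion_const wlo uhi k) => N p Key V hash s stg ratio szs.
  exact: insertion_cost stg ratio szs.
move=> d; exists (query_const wlo ulo uhi k klo d), (query_N0 ulo klo).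
move=> c N p Key V Seed mu hash kappa s x N0N stg ratio dis kap indep us szs cd.
exact: (query_cost_whp wlo_gt0 ulo_gt0 uhi_gt0 k_ge2 klo_gt0 x N0N stg ratio dis kap
  indep us szs cd).
Qed.
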